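(* Let $J$ be the Jordan superalgebra $H(A,* )$, where $A$ is a finite dimensional simple associative superalgebra over an algebraically closed field of characteristic zero, and $*$ is a superinvolution in $A$. Let $B$ be a subalgebra of $J$ such that $B'\neq A$. Then $B$ is a maximal subalgebra of $J$ if and only if there are even idempotents $e,f\in A$ with $e+f=1$ such that $B=H(C,* )$ and one of the following possibilities occurs: (i) either $C=eAe+fAf$, $e^*=e$, $f^*=f$, $H(eAe,* )'=eAe$, and $H(fAf,* )'=fAf$; (ii) or $C=eA+Ae^*+ff^*Aff^*$, with $H(ff^*Aff^*,* )'=ff^*Aff^*$.
   Context: A superalgebra is a $\mathbb Z_2$-graded algebra $A=A_{\bar 0}\oplus A_{\bar 1}$; it is simple if its product is nonzero and it has no proper nonzero graded ideal. All subalgebras are graded; maximal subalgebras are proper ones maximal among proper graded subalgebras. For an associative superalgebra $A$, $A^+$ is the Jordan superalgebra on the vector space $A$ with product $x\circ y=\frac12(xy+(-1)^{\bar x\bar y}yx)$ for homogeneous $x,y$ of degrees $\bar x,\bar y$. A superinvolution $*$ of $A$ is a graded linear map $A\to A$ with $x^{**}=x$ and $(xy)^*=(-1)^{\bar x\bar y}y^*x^*$ for homogeneous $x,y$. For a $*$-stable graded subspace $C$ of $A$, $H(C,* )=\{c\in C: c^*=c\}$; in particular $H(A,* )$ is a subalgebra of $A^+$. For a subset $S$ of $A$, such as $B$, $H(eAe,* )$, $H(fAf,* )$ or $H(ff^*Aff^*,* )$, $S'$ denotes the associative subalgebra of $A$ generated by $S$.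
   Formalization: The formal theorem adds the hypothesis dim J > 2; without it the claim fails, e.g. for A = F, B = 0 (maximal, of neither form), or for A = M_2(F) with the symplectic involution and B = J = F1, which has form (ii) but is not proper. *)

(* Defs.v *)
From HB Require Import structures.
From mathcomp Require Import all_boot all_order all_algebra all_field.

Set Implicit Arguments.
Unset Strict Implicit.
Unset Printing Implicit Defensive.

Import GRing.Theory.
Local Open Scope ring_scope.

Section SuperDefs.
Variables (F : fieldType) (A : falgType F).

(* A grading is a family G : bool -> {vspace A} indexed by Z/2Z = (bool, (+)),
   with G false the even part and G true the odd part. *)
Definition super_grading (G : bool -> {vspace A}) : Prop :=
  [/\ (G false + G true)%VS = {:A}%VS,
      (G false :&: G true)%VS = 0%VS
    & forall a b : bool, (G a * G b <= G (a (+) b))%VS].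

Definition graded_subspace (G : bool -> {vspace A}) (U : {vspace A}) : Prop :=
  U = ((U :&: G false) + (U :&: G true))%VS.

(* [mul] is the product under consideration on the subspace J of A: the
   associative product *%R or the Jordan superproduct [jordan_mul G] below. *)
Definition graded_subalgebra (G : bool -> {vspace A}) (mul : A -> A -> A)
    (J B : {vspace A}) : Prop :=
  [/\ (B <= J)%VS, graded_subspace G B
    & forall x y, x \in B -> y \in B -> mul x y \in B].

Definition graded_ideal (G : bool -> {vspace A}) (mul : A -> A -> A)
    (J I : {vspace A}) : Prop :=
  [/\ (I <= J)%VS, graded_subspace G I
    & forall x y, x \in J -> y \in I -> mul x y \in I /\ mul y x \in I].

Definition simple_superalgebra (G : bool -> {vspace A}) (mul : A -> A -> A)
    (J : {vspace A}) : Prop :=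
  (exists x y, [/\ x \in J, y \in J & mul x y != 0]) /\
  (forall I : {vspace A}, graded_ideal G mul J I -> I = 0%VS \/ I = J).

Definition maximal_subalgebra (G : bool -> {vspace A}) (mul : A -> A -> A)
    (J B : {vspace A}) : Prop :=
  [/\ graded_subalgebra G mul J B, B <> J
    & forall D : {vspace A}, graded_subalgebra G mul J D -> D <> J ->
        (B <= D)%VS -> D = B].

Definition homog_part (G : bool -> {vspace A}) (a : bool) : 'End(A) :=
  daddv_pi (G a) (G (~~ a)).

(* The bilinear extension of the Jordan product of homogeneous elements. *)
Definition jordan_mul (G : bool -> {vspace A}) (x y : A) : A :=
  2%:R^-1 *: \sum_(a : bool) \sum_(b : bool)
    (homog_part G a x * homog_part G b y
     + (-1) ^+ (a && b) * (homog_part G b y * homog_part G a x)).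

Definition superinvolution (G : bool -> {vspace A}) (star : 'End(A)) : Prop :=
  [/\ forall a : bool, (star @: G a <= G a)%VS,
      forall x, star (star x) = x
    & forall (a b : bool) x y, x \in G a -> y \in G b ->
        star (x * y) = (-1) ^+ (a && b) * (star y * star x)].

Definition herm_elts (star : 'End(A)) (C : {vspace A}) : {vspace A} :=
  (C :&: fixedSpace star)%VS.

(* [agenv S] is the sum of all powers S ^ i with i >= 0, and so contains 1;
   the algebra generated by S without adjoining 1 is the sum over i >= 1. *)
Definition gen_alg (S : {vspace A}) : {vspace A} := (S * agenv S)%VS.

Definition even_idempotent (G : bool -> {vspace A}) (e : A) : Prop :=
  e \in G false /\ e * e = e.

Definition corner (e : A) : {vspace A} := (<[e]> * {:A} * <[e]>)%VS.
Definition right_ideal (e : A) : {vspace A} := (<[e]> * {:A})%VS.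
Definition left_ideal (e : A) : {vspace A} := ({:A} * <[e]>)%VS.

Lemma gen_alg_spec (S : {vspace A}) :
  [/\ (S <= gen_alg S)%VS, (gen_alg S * gen_alg S <= gen_alg S)%VS
    & forall T : {vspace A}, (S <= T)%VS -> (T * T <= T)%VS ->
        (gen_alg S <= T)%VS].
Proof.
split=> [||T sST TT]; rewrite /gen_alg.
- by rewrite -{1}[S]prodv1 prodvSr ?sub1_agenv.
- rewrite -prodvA prodvSr // prodvA -[X in (_ <= X)%VS]agenvM prodvSl //.
  by rewrite -[X in (_ <= X)%VS]agenvM prodvSr // sub_agenv.
have TS : (T * S <= T)%VS by apply: subv_trans TT; rewrite prodvSr.
exact: subv_trans (prodvSl _ sST) (agenv_modr TS).
Qed.

Lemma homog_partE (G : bool -> {vspace A}) (a b : bool) (x : A) :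
  super_grading G -> x \in G a -> homog_part G b x = if b == a then x else 0.
Proof.
move=> [sG dG _] xa.
have dab c : (G c :&: G (~~ c))%VS = 0%VS by case: c; rewrite //= capvC.
have pid : homog_part G a x = x by exact: daddv_pi_id.
case: eqVneq => [-> //|nba].
have -> : b = ~~ a by case: a b nba {xa pid} => [] [].
have xs : x \in (G a + G (~~ a))%VS.
  suff -> : (G a + G (~~ a))%VS = {:A}%VS by exact: memvf.
  by case: (a); rewrite //= addvC.
have := daddv_pi_add (dab a) xs; rewrite -/(homog_part G a) pid.
by rewrite /homog_part negbK -{3}[x]addr0 => /addrI.
Qed.

Lemma jordan_mul_homog (G : bool -> {vspace A}) (a b : bool) (x y : A) :
  super_grading G -> x \in G a -> y \in G b ->
  jordan_mul G x y = 2%:R^-1 *: (x * y + (-1) ^+ (a && b) * (y * x)).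
Proof.
move=> sG xa yb; rewrite /jordan_mul (bigD1 a) //= (bigD1 b) //=.
rewrite !(homog_partE _ sG xa) !(homog_partE _ sG yb) !eqxx.
rewrite !big1 ?addr0 // => [c /negPf nca|c /negPf ncb]; last first.
  by rewrite (homog_partE _ sG yb) ncb mulr0 mul0r mulr0 addr0.
rewrite big1 // => d _; rewrite (homog_partE _ sG xa) nca.
by rewrite mulr0 mul0r mulr0 addr0.
Qed.

End SuperDefs.

(* Main.v *)
Require Import Defs.
From HB Require Import structures.
From mathcomp Require Import all_boot all_order all_algebra all_field.
From Stdlib Require Import Classical.

Set Implicit Arguments.
Unset Strict Implicit.
Unset Printing Implicit Defensive.

Import GRing.Theory.
Local Open Scope ring_scope.

(** The proof is the classical one for algebras of endomorphisms of a space with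
    a form, carried out inside [A]. A graded subspace of the space becomes a
    graded right ideal, always of the form [e A] with [e] an even idempotent
    ([right_ideal_generator]); its orthogonal is [(1 - e^* ) A]; so [e A] is
    isotropic when [e^* e = 0], and the orthogonal of [e A] complements it when
    [e] can be chosen with [e^* = e].

    Two facts carry the proof. First, a *-stable graded unital subalgebra of a
    corner [e A e] ([e^* = e]) that stabilizes no proper nonzero right ideal is
    the whole corner ([irreducible_full], a Burnside theorem). A nonzero element
    of minimal rank yields a primitive even idempotent; the alternative in which
    an odd element squares to that idempotent, as in the superalgebras [Q(n)],
    is incompatible with a superinvolution ([odd_square_one_false]). Second, if
    the Hermitian elements of [e A e] do not generate it, then [e = k + k^*] with
    [k] isotropic and [k^* h k = 0] for every Hermitian [h]
    ([hyperbolic_split]); when [e = 1] this forces [k A k] to be one-dimensional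
    and [H(A)] to have dimension at most 2. So [H(A)], being of larger dimension,
    generates [A] ([gen_alg_hermf]).

    Let [B] be maximal with [B' <> A]. Any proper graded *-stable subalgebra [M]
    containing [B] satisfies [B = H(M)]. By the first fact the unital hull of
    [B'] stabilizes a proper right ideal. A minimal one, [e A], meets its
    orthogonal in [0] or in [e A]. In the first case [e^* = e] may be assumed and
    [B = H(e A e + f A f)]. In the second [B] is the Hermitian part of the
    stabilizer of [e A], a parabolic [e A + A e^* + g A g] with [g = f f^*]. If
    the Hermitian elements of one of the diagonal corners failed to generate it,
    the isotropic ideal given by the second fact would be stable under [B], and
    the Hermitian part of its stabilizer would be strictly larger than [B].

    Conversely, in form (ii) a nonzero [e^* e] would give
    [z + z^* \in C] for all [z], so [B] would be [H(A)], which generates [A]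
    ([nonisotropic_fills]); hence [e A] is isotropic. Let [D] be a Jordan
    subalgebra containing [B] and an element outside [C]. Its Peirce components
    outside [C] lie in [D] as well, and the corners, generated by their
    Hermitian elements, move a nonzero component over its whole Peirce space by
    simplicity of [A] ([levi_fills], [parabolic_fills]); so [D = H(A)].

    Signs hardly appear: the Jordan product of Hermitian [x] and [y] is half of
    [trace (x y)], where [trace z = z + z^*]. *)

(** * Linear predicates and eigenvectors *)

Lemma ex_minimal (T : Type) (f : T -> nat) (P : T -> Prop) :
  (exists x, P x) -> exists2 x, P x & forall y, P y -> (f x <= f y)%N.
Proof.
case=> x; have [n] := ubnP (f x); elim: n => // n IHn in x *.
rewrite ltnS => fxn Px; case: (classic (exists2 y, P y & (f y < f x)%N)).
  by case=> y Py lt_yx; apply: IHn Py; apply: leq_trans lt_yx fxn.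
move=> nlt; exists x => // y Py; rewrite leqNgt; apply/negP=> lt_yx.
by apply: nlt; exists y.
Qed.

Section LinearPredicates.
Variables (F : fieldType) (V : vectType F).

(** Subspaces given by a proposition rather than by a decidable membership; [vspace_of]
    turns them into genuine subspaces. *)
Definition lin_closed (P : V -> Prop) : Prop :=
  P 0 /\ forall c x y, P x -> P y -> P (c *: x + y).

(** A subspace of largest dimension among those contained in [P] is all of [P]. *)
Lemma vspace_of (P : V -> Prop) :
  lin_closed P -> exists U : {vspace V}, forall x, x \in U <-> P x.
Proof.
case=> P0 Pl; pose Q (U : {vspace V}) := forall x, x \in U -> P x.
have [] := @ex_minimal _ (fun U : {vspace V} => \dim {:V} - \dim U)%N Q.
  by exists 0%VS => x; rewrite memv0 => /eqP->.
move=> U QU maxU; exists U => x; split=> [/QU //|Px].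
apply: contraT => xU.
have QUx : Q (<[x]> + U)%VS.
  move=> y /memv_addP[u /vlineP[c ->] [v vU ->]].
  by apply: Pl => //; apply: QU.
have := maxU _ QUx; rewrite leqNgt => /negP[]; apply: ltn_sub2l.
  rewrite ltn_neqAle dimvS ?subvf // andbT.
  apply: contra xU => /eqP dU; have := subvf U.
  by move/dimv_leqif_eq => [_]; rewrite dU eqxx => /esym/eqP ->; rewrite memvf.
rewrite ltn_neqAle dimvS ?addvSr // andbT.
have [_ ->] := dimv_leqif_sup (addvSr <[x]> U).
by rewrite subv_add -memvE (negPf xU).
Qed.

End LinearPredicates.

(** Proves that a membership or an equation whose two sides are linear in the
    argument is a linear predicate. *)
Ltac lin_tac :=
  let c := fresh "c" in let x := fresh "x" in let y := fresh "y" in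
  let Px := fresh "Px" in let Py := fresh "Py" in
  split=> [|c x y Px Py];
  rewrite ?(linear0, mulr0, mul0r, linearP, mulrDr, mulrDl,
            =^~ scalerAl, =^~ scalerAr) /= ?(mem0v, memvD, memvZ) //
    ?(Px, Py, scaler0, addr0) //.

Section Closed.
Variable F : closedFieldType.

Lemma closed_sqrt (c : F) : exists d, d * d = c.
Proof.
have /closed_rootP[d] : size ('X^2 - c%:P) != 1 by rewrite size_XnsubC.
by rewrite rootE !hornerE subr_eq0 => /eqP; exists d.
Qed.

(** If [p] is a nonzero polynomial of least degree with [p(x) u0 = 0], and [p = q (X - c)],
    then [q(x) u0] is an eigenvector for [c]. *)
Lemma eigenvector (A : falgType F) (x : A) (U : {vspace A}) (u0 : A) :
  (forall u, u \in U -> x * u \in U) -> u0 \in U -> u0 != 0 ->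
  exists c u, [/\ u \in U, u != 0 & x * u = c *: u].
Proof.
move=> xU u0U u0n0; pose ev (p : {poly F}) := horner_alg x p * u0.
have evX p : ev (p * 'X) = x * ev p.
  by rewrite /ev mulrC rmorphM /= horner_algX mulrA.
have evC c : ev c%:P = c *: u0 by rewrite /ev horner_algC mulr_algl.
have evD p q : ev (p + q) = ev p + ev q by rewrite /ev rmorphD mulrDl.
have evU p : ev p \in U.
  elim/poly_ind: p => [|p c IHp]; first by rewrite /ev linear0 mul0r mem0v.
  by rewrite evD evX evC memvD ?xU ?memvZ.
have [p [pn0 evp]] : exists p, p != 0 /\ ev p = 0.
  apply: NNPP => none; pose n := \dim {:A}.
  pose X := [tuple x ^+ i * u0 | i < n.+1].
  have /freeP free : forall k : 'I_n.+1 -> F,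
      \sum_(i < n.+1) k i *: X`_i = 0 ->
      forall i, k i = 0.
    move=> k sum0 i; pose p := \poly_(i < n.+1) k (inord i).
    suff /polyP/(_ i) : p = 0 by rewrite coef0 coef_poly ltn_ord inord_val.
    apply/eqP/negPn/negP=> pn0; apply: none; exists p; split=> //.
    rewrite /ev /p poly_def linear_sum mulr_suml -[RHS]sum0; apply: eq_bigr => j _.
    rewrite linearZ /= rmorphXn /= horner_algX -scalerAl inord_val.
    by rewrite (nth_map j) ?size_enum_ord ?ltn_ord // nth_ord_enum mul1r -scalerAl.
  have := dimvS (subvf <<X>>%VS).
  by move: free; rewrite /free size_tuple => /eqP->; rewrite ltnn.
have [{pn0 evp}p [pn0 evp] minp] :=
  @ex_minimal _ (fun p : {poly F} => size p) (fun p => p != 0 /\ ev p = 0)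
    (ex_intro _ p (conj pn0 evp)).
have /closed_rootP[c /factor_theorem[q pE]] : size p != 1.
  apply/eqP=> /eqP/size_poly1P[c cn0 pE]; move/eqP: evp.
  by rewrite pE evC scaler_eq0 (negPf cn0) (negPf u0n0).
have qn0 : q != 0 by apply: contra pn0; rewrite pE => /eqP->; rewrite mul0r.
exists c, (ev q); split=> //.
  apply/eqP=> evq; have := minp q (conj qn0 evq).
  by rewrite pE size_Mmonic ?monicXsubC // size_XsubC addn2 /= ltnn.
apply/eqP; rewrite -subr_eq0 -evp pE mulrBr evD evX; apply/eqP; congr (_ + _).
by rewrite [q * _]mulrC /ev rmorphN rmorphM /= horner_algC mulNr mulr_algl -scalerAl.
Qed.

End Closed.

(** * Ideals and corners *)

Section Algebra.
Variables (F : fieldType) (A : falgType F).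
Implicit Types (U V W : {vspace A}) (e x y : A).

Lemma prodv_ind U V (P : A -> Prop) : lin_closed P ->
  (forall u v, u \in U -> v \in V -> P (u * v)) ->
  forall x, x \in (U * V)%VS -> P x.
Proof.
move=> /vspace_of[W WP] Puv x; rewrite -WP; apply: subvP x.
by apply/prodvP=> u v uU vV; apply/WP/Puv.
Qed.

Lemma prodv3_ind U x V (P : A -> Prop) : lin_closed P ->
  (forall u v, u \in U -> v \in V -> P (u * x * v)) ->
  forall y, y \in (U * <[x]> * V)%VS -> P y.
Proof.
move=> linP Puv; apply: prodv_ind => // w v wUx vV; move: w wUx v vV.
have [P0 Pl] := linP; apply: prodv_ind.
  split=> [v _|c y z Py Pz v vV]; first by rewrite mul0r.
  by rewrite mulrDl -scalerAl; apply: Pl; [apply: Py|apply: Pz].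
move=> u _ uU /vlineP[c ->] v vV.
by rewrite -scalerAr -scalerAl scalerAr; apply/Puv/memvZ.
Qed.

Lemma right_idealP e x : reflect (exists a, x = e * a) (x \in right_ideal e).
Proof.
apply: (iffP idP) => [|[a ->]]; last by rewrite memv_mul ?memv_line ?memvf.
move: x; apply: prodv_ind.
  split=> [|c y z [a ->] [b ->]]; first by exists 0; rewrite mulr0.
  by exists (c *: a + b); rewrite mulrDr scalerAr.
by move=> u v /vlineP[c ->] _; exists (c *: v); rewrite -scalerAl scalerAr.
Qed.

Lemma left_idealP e x : reflect (exists a, x = a * e) (x \in left_ideal e).
Proof.
apply: (iffP idP) => [|[a ->]]; last by rewrite memv_mul ?memv_line ?memvf.
move: x; apply: prodv_ind.
  split=> [|c y z [a ->] [b ->]]; first by exists 0; rewrite mul0r.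
  by exists (c *: a + b); rewrite mulrDl scalerAl.
by move=> u v _ /vlineP[c ->]; exists (c *: u); rewrite -scalerAr scalerAl.
Qed.

Lemma cornerP e x : reflect (exists a, x = e * a * e) (x \in corner e).
Proof.
apply: (iffP idP) => [|[a ->]]; last first.
  by rewrite !memv_mul ?memv_line ?memvf.
move: x; apply: prodv_ind.
  split=> [|c y z [a ->] [b ->]]; first by exists 0; rewrite mulr0 mul0r.
  by exists (c *: a + b); rewrite mulrDr mulrDl -scalerAr scalerAl.
move=> u v /right_idealP[a ->] /vlineP[c ->].
by exists (c *: a); rewrite -!(scalerAr, scalerAl).
Qed.

Lemma right_ideal_idem e x : e * e = e -> (x \in right_ideal e) = (e * x == x).
Proof.
move=> ee; apply/right_idealP/eqP=> [[a ->]|<-]; first by rewrite mulrA ee.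
by exists x.
Qed.

Lemma corner_idem e x : e * e = e ->
  reflect (e * x = x /\ x * e = x) (x \in corner e).
Proof.
move=> ee; apply: (iffP (cornerP e x)) => [[a ->]|[ex xe]].
  by rewrite -!mulrA ee !mulrA ee.
by exists x; rewrite ex xe.
Qed.

Lemma gen_alg_ind (S : {vspace A}) (P : A -> Prop) : lin_closed P ->
  (forall x, x \in S -> P x) -> (forall x y, P x -> P y -> P (x * y)) ->
  forall x, x \in gen_alg S -> P x.
Proof.
move=> /vspace_of[W WP] PS Pmul x; rewrite -WP.
have [_ _ mini] := gen_alg_spec S; apply: subvP (mini W _ _) x.
  by apply/subvP=> x /PS /WP.
by apply/prodvP=> u v /WP Pu /WP Pv; apply/WP/Pmul.
Qed.

End Algebra.

(** * Graded subspaces *)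

Section Super.
Variables (F : closedFieldType) (A : falgType F) (G : bool -> {vspace A}).
Hypothesis gradA : super_grading G.
Implicit Types (U V W : {vspace A}) (e x y : A) (a b : bool).

Local Notation part a := (homog_part G a).

Lemma mem_part a x : part a x \in G a.
Proof. exact: memv_pi. Qed.

Lemma part_sum x : part false x + part true x = x.
Proof. by case: gradA => sG dG _; rewrite daddv_pi_add // sG memvf. Qed.

Lemma homog_ind (P : A -> Prop) : lin_closed P ->
  (forall a x, x \in G a -> P x) -> forall x, P x.
Proof.
move=> [_ Pl] PG x; rewrite -(part_sum x) -[part false x]scale1r.
by apply: Pl; apply: PG (mem_part _ _).
Qed.

Lemma homogM a b x y : x \in G a -> y \in G b -> x * y \in G (a (+) b).
Proof. by move=> xa yb; case: gradA => _ _ /(_ a b)/subvP; apply; apply: memv_mul. Qed.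

Lemma even_mull a x y : x \in G false -> y \in G a -> x * y \in G a.
Proof. exact: homogM. Qed.

Lemma even_mulr a x y : x \in G a -> y \in G false -> x * y \in G a.
Proof. by move=> xa /(homogM xa); rewrite addbF. Qed.

(** The odd part of [1] annihilates every homogeneous [x], because [1 * x] has no
    component of the opposite parity. *)
Lemma one_even : (1 : A) \in G false.
Proof.
suff v0 x : part true 1 * x = 0.
  by rewrite -(part_sum 1) -[part true 1]mulr1 v0 addr0 mem_part.
move: x; apply: homog_ind => [|a x xa].
  by lin_tac.
have /(congr1 (part (~~ a))) : part false 1 * x + part true 1 * x = x.
  by rewrite -mulrDl part_sum mul1r.
rewrite linearD /= (homog_partE _ gradA xa).
rewrite (homog_partE _ gradA (homogM (mem_part false 1) xa)).
rewrite (homog_partE _ gradA (homogM (mem_part true 1) xa)).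
by case: (a); rewrite /= add0r.
Qed.


Lemma gradedP U :
  graded_subspace G U <-> forall a x, x \in U -> part a x \in U.
Proof.
have sub : (((U :&: G false) + (U :&: G true)) <= U)%VS.
  by rewrite subv_add !capvSl.
split=> [gU a x | gU]; last first.
  apply/eqP; rewrite eqEsubv sub andbT; apply/subvP=> x xU.
  by rewrite -(part_sum x) memv_add // memv_cap gU ?mem_part.
rewrite {1}gU => /memv_addP[y /memv_capP[yU y0] [z /memv_capP[zU z1] ->]].
rewrite linearD /= (homog_partE _ gradA y0) (homog_partE _ gradA z1).
by case: a; rewrite /= ?addr0 ?add0r.
Qed.

Lemma graded_line a x : x \in G a -> graded_subspace G <[x]>.
Proof.
move=> xa; apply/gradedP=> b _ /vlineP[c ->].
by rewrite linearZ /= (homog_partE _ gradA xa) memvZ //; case: ifP;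
  rewrite ?memv_line ?mem0v.
Qed.

Lemma gradedf : graded_subspace G {:A}%VS.
Proof. by apply/gradedP=> a x _; apply: memvf. Qed.

Lemma part_mul a x y :
  part a (x * y) = part false x * part a y + part true x * part (~~ a) y.
Proof.
rewrite -{1}(part_sum x) -{1}(part_sum y) !mulrDl !mulrDr !linearD /=.
by do !rewrite (homog_partE _ gradA (homogM (mem_part _ _) (mem_part _ _)));
  case: a; rewrite /= ?addr0 ?add0r // addrC.
Qed.

Lemma graded_prodv U V :
  graded_subspace G U -> graded_subspace G V -> graded_subspace G (U * V)%VS.
Proof.
move=> /gradedP gU /gradedP gV; apply/gradedP=> a; apply: prodv_ind.
  by lin_tac.
by move=> u v uU vV; rewrite part_mul memvD // memv_mul ?gU ?gV.
Qed.

Lemma graded_addv U V :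
  graded_subspace G U -> graded_subspace G V -> graded_subspace G (U + V)%VS.
Proof.
move=> /gradedP gU /gradedP gV; apply/gradedP=> a x /memv_addP[u uU [v vV ->]].
by rewrite linearD /= memv_add ?gU ?gV.
Qed.

Lemma graded_capv U V :
  graded_subspace G U -> graded_subspace G V -> graded_subspace G (U :&: V)%VS.
Proof.
move=> /gradedP gU /gradedP gV; apply/gradedP=> a x /memv_capP[xU xV].
by rewrite memv_cap gU ?gV.
Qed.

Lemma graded_homog_notin U V : graded_subspace G U -> ~~ (U <= V)%VS ->
  exists a x, [/\ x \in G a, x \in U & x \notin V].
Proof.
move=> /gradedP gU /subvPn[x xU xV].
case xV0: (part false x \in V).
  exists true, (part true x); rewrite mem_part gU //; split=> //.
  by apply: contra xV => xV1; rewrite -(part_sum x) memvD.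
by exists false, (part false x); rewrite mem_part gU // xV0.
Qed.

Lemma graded_gen_alg U : graded_subspace G U -> graded_subspace G (gen_alg U).
Proof.
move=> /gradedP gU; have [sub mul _] := gen_alg_spec U.
suff gen x : x \in gen_alg U -> forall a, part a x \in gen_alg U.
  by apply/gradedP=> a x /gen.
move: x; apply: gen_alg_ind => [|x xU a|x y Px Py a].
- split=> [a|c x y Px Py a]; first by rewrite linear0 mem0v.
  by rewrite linearP /= memvD ?memvZ ?Px ?Py.
- exact/(subvP sub)/gU.
by rewrite part_mul memvD //; apply: (subvP mul); rewrite memv_mul.
Qed.

(** * Superinvolutions *)

Variable star : 'End(A).
Hypothesis starP : superinvolution G star.

Lemma starK x : star (star x) = x.
Proof. by case: starP. Qed.

Lemma star_inj : injective star.
Proof. exact: can_inj starK. Qed.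

Lemma star_homog a x : x \in G a -> star x \in G a.
Proof. by move=> xa; case: starP => /(_ a)/subvP sG _ _; apply/sG/memv_img. Qed.

Lemma starM a b x y : x \in G a -> y \in G b ->
  star (x * y) = if a && b then - (star y * star x) else star y * star x.
Proof. by case: starP => _ _ H xa yb; rewrite (H a b) // mulr_sign. Qed.

Lemma star_evenl e x : e \in G false -> star (e * x) = star x * star e.
Proof.
move=> e0; move: x; apply: homog_ind => [|a x xa]; first by lin_tac.
by rewrite (starM e0 xa).
Qed.

Lemma star_evenr e x : e \in G false -> star (x * e) = star e * star x.
Proof.
move=> e0; move: x; apply: homog_ind => [|a x xa]; first by lin_tac.
by rewrite (starM xa e0) andbF.
Qed.

Lemma star1 : star 1 = 1.
Proof.
by have := star_evenl (star 1) one_even; rewrite mul1r starK mul1r => <-.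
Qed.

Lemma star_part a x : part a (star x) = star (part a x).
Proof.
rewrite -{1}(part_sum x) !linearD /=.
rewrite (homog_partE _ gradA (star_homog (mem_part false x))).
rewrite (homog_partE _ gradA (star_homog (mem_part true x))).
by case: a; rewrite /= ?add0r ?addr0.
Qed.

Lemma hermP U x :
  reflect (x \in U /\ star x = x) (x \in herm_elts star U).
Proof.
by apply: (iffP memv_capP) => -[xC /fixedSpaceP].
Qed.

Lemma graded_herm U : graded_subspace G U -> graded_subspace G (herm_elts star U).
Proof.
move=> gC; apply: graded_capv => //; apply/gradedP=> a x /fixedSpaceP sx.
by apply/fixedSpaceP; rewrite -star_part sx.
Qed.

(** The sum [x + x^*], which maps onto the Hermitian elements when 2 is invertible. *)
Definition trace : 'End(A) := (\1 + star)%VF.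

Lemma traceE x : trace x = x + star x.
Proof. by rewrite /trace add_lfunE id_lfunE. Qed.

Lemma star_trace x : star (trace x) = trace x.
Proof. by rewrite !traceE linearD /= starK addrC. Qed.

Lemma trace_star x : trace (star x) = trace x.
Proof. by rewrite !traceE starK addrC. Qed.

Hypothesis two_neq0 : 2%:R != 0 :> F.

Lemma half_trace x : star x = x -> x = 2%:R^-1 *: trace x.
Proof.
by move=> sx; rewrite !traceE sx -mulr2n -scaler_nat scalerA mulVf // scale1r.
Qed.

(** The signs of the superproduct are those of the superinvolution, so they
    disappear once the product is written with the trace. *)
Lemma jordan_mul_herm x y : star x = x -> star y = y ->
  jordan_mul G x y = 2%:R^-1 *: trace (x * y).
Proof.
move=> sx sy; rewrite /jordan_mul; congr (_ *: _).
rewrite -[in RHS](part_sum x) -[in RHS](part_sum y) !mulrDl !mulrDr.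
have tr a b : part a x * part b y + (-1) ^+ (a && b) * (part b y * part a x)
    = trace (part a x * part b y).
  rewrite !traceE (starM (mem_part a x) (mem_part b y)) mulr_sign.
  by rewrite -!star_part sx sy.
under eq_bigr do under eq_bigr do rewrite tr.
by rewrite !big_bool /= !linearD /= addrC [X in _ + X]addrC [X in X + _]addrC.
Qed.

Lemma jordan_trace (J D : {vspace A}) x y : J = herm_elts star {:A}%VS ->
  graded_subalgebra G (jordan_mul G) J D ->
  x \in D -> y \in D -> trace (x * y) \in D.
Proof.
move=> -> [/subvP DJ _ mulD] xD yD; have := mulD _ _ xD yD.
have [[_ sx] [_ sy]] := (hermP _ _ (DJ _ xD), hermP _ _ (DJ _ yD)).
rewrite jordan_mul_herm // => /(memvZ 2%:R).
by rewrite scalerA divff // scale1r.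
Qed.

Lemma herm_jordan (M : {vspace A}) : graded_subspace G M ->
  (M * M <= M)%VS -> (forall x, x \in M -> star x \in M) ->
  graded_subalgebra G (jordan_mul G) (herm_elts star {:A}%VS) (herm_elts star M).
Proof.
move=> gM /prodvP mulM sM; split; first exact: capvS (subvf _) (subvv _).
  exact: graded_herm.
move=> x y /hermP[xM sx] /hermP[yM sy]; rewrite jordan_mul_herm //.
apply/memvZ/hermP; split; last exact: star_trace.
by rewrite !traceE memvD ?sM ?mulM.
Qed.

Lemma gen_alg_star U : graded_subspace G U ->
  (forall x, x \in U -> star x \in U) ->
  forall x, x \in gen_alg U -> star x \in gen_alg U.
Proof.
move=> gU sU; have [sub /prodvP mul _] := gen_alg_spec U.
have /gradedP gg := graded_gen_alg gU.
suff gen x : x \in gen_alg U -> forall a, star (part a x) \in gen_alg U.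
  by move=> x xU; rewrite -(part_sum x) linearD /= memvD ?gen.
move: x; apply: gen_alg_ind => [|x xU a|x y Px Py a].
- split=> [a|c x y Px Py a]; first by rewrite 2!linear0 mem0v.
  by rewrite 2!linearP /= memvD ?memvZ ?Px ?Py.
- by apply/(subvP sub)/sU; move/gradedP: gU; apply.
have star_prod b c : star (part b x * part c y) \in gen_alg U.
  rewrite (starM (mem_part b x) (mem_part c y)).
  by case: ifP => _; rewrite ?rpredN; apply: mul.
by rewrite part_mul linearD /= memvD.
Qed.

(** * Primitive idempotents *)

Definition star_subalgebra (M : {vspace A}) : Prop :=
  [/\ graded_subspace G M, forall x y, x \in M -> y \in M -> x * y \in M
    & forall x, x \in M -> star x \in M].

Definition graded_prime (M : {vspace A}) : Prop :=
  forall a b x y, x \in M -> y \in M -> x \in G a -> y \in G b ->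
    x != 0 -> y != 0 -> exists c z, [/\ z \in M, z \in G c & x * z * y != 0].

(** The superalgebras [Q(n)] have no superinvolution. The even part of [p^* M p]
    is a line [F t], so [t^*] is a multiple of [t], and [u^* t] is a multiple
    [d] of [t u]. Applying the involution gives [d^2 = 1], so
    [u^* u^* t = t], whereas the sign rule gives [u^* u^* = - (u u)^* = - p^*]. *)
Lemma odd_square_one_false M p u :
  star_subalgebra M -> graded_prime M ->
  p \in M -> p \in G false -> p * p = p -> p != 0 ->
  (forall x, x \in M -> x \in G false -> exists c, p * x * p = c *: p) ->
  u \in M -> u \in G true -> p * u = u -> u * p = u -> u * u = p -> False.
Proof.
move=> [/gradedP gM mulM sM] primeM pM p0 pp pn0 pMp uM u1 pu up uu.
pose q := star p; have qM : q \in M by apply: sM.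
have q0 : q \in G false by apply: star_homog.
have qq : q * q = q by rewrite -(star_evenl _ p0) pp.
have qn0 : q != 0 by rewrite -(inj_eq star_inj) starK linear0.
(* t spans the even part of q M p, and s in p M q inverts it. *)
have [t [tM t0 tn0 [qt tp]]] :
    exists t, [/\ t \in M, t \in G false, t != 0 & q * t = t /\ t * p = t].
  have [c [z [zM zc qzp]]] := primeM _ _ _ _ qM pM q0 p0 qn0 pn0.
  case: c zc => zc.
    exists (q * z * p * u); rewrite !mulM //; split=> //.
    - exact: homogM (homogM (homogM q0 zc) p0) u1.
    - apply: contra qzp => /eqP qzpu.
      have -> : q * z * p = q * z * p * u * u by rewrite -[RHS]mulrA uu -[RHS]mulrA pp.
      by rewrite qzpu mul0r.
    by split; [rewrite !mulrA qq | rewrite -[LHS]mulrA up].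
  exists (q * z * p); rewrite !mulM //; split=> //.
    exact: homogM (homogM q0 zc) p0.
  by split; [rewrite !mulrA qq | rewrite -[LHS]mulrA pp].
have [s [s_M s0 ps st]] : exists s, [/\ s \in M, s \in G false, p * s = s & s * t = p].
  have [c [z [zM zc tzt]]] := primeM _ _ _ _ tM tM t0 t0 tn0 tn0.
  have pzt : p * z * t != 0.
    apply: contra tzt => /eqP pzt.
    have -> : t * z * t = t * (p * z * t) by rewrite !mulrA tp.
    by rewrite pzt mulr0.
  have [w [wM w0 wt wn0]] : exists w, [/\ w \in M, w \in G false, p * w = w & w * t != 0].
    case: c zc => zc; last first.
      by exists (p * z); rewrite mulM // mulrA pp; split=> //; apply: homogM p0 zc.
    exists (u * z); rewrite mulM // mulrA pu; split=> //; first exact: homogM u1 zc.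
    apply: contra pzt => /eqP uzt.
    have -> : p * z * t = u * (u * z * t) by rewrite !mulrA uu.
    by rewrite uzt mulr0.
  have [k] := pMp _ (mulM _ _ wM tM) (homogM w0 t0).
  rewrite mulrA wt -mulrA tp => wtk.
  have kn0 : k != 0 by apply: contra wn0 => /eqP k0; rewrite wtk k0 scale0r.
  exists (k^-1 *: w); rewrite -scalerAr wt -scalerAl wtk scalerA mulVf // scale1r.
  by rewrite !memvZ.
have line x : x \in M -> x \in G false -> q * x = x -> x * p = x ->
    exists c, x = c *: t.
  move=> xM x0 qx xp.
  have [c tsc] : exists c, t * s * q = c *: q.
    have [c] := pMp (star (t * s * q)) (sM _ (mulM _ _ (mulM _ _ tM s_M) qM))
      (star_homog (homogM (homogM t0 s0) q0)).
    move/(congr1 star); rewrite linearZ /= star_evenr // star_evenl // starK -/q.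
    by rewrite !mulrA qt -mulrA qq; exists c.
  have [d sxd] := pMp _ (mulM _ _ s_M xM) (homogM s0 x0).
  have tE : t = c *: t.
    have /esym := congr1 ( *%R^~ t) tsc.
    by rewrite -scalerAl -[RHS]mulrA qt -[RHS]mulrA st tp.
  have cn0 : c != 0 by apply: contra tn0 => /eqP c0; rewrite tE c0 scale0r.
  exists (c^-1 * d); rewrite -scalerA.
  have <- : c *: x = d *: t.
    have := congr1 ( *%R^~ x) tsc; rewrite -scalerAl -!mulrA qx => <-.
    have := congr1 ( *%R t) sxd; rewrite -scalerAr tp -!mulrA xp => <-.
    by rewrite [t * (p * _)]mulrA tp.
  by rewrite scalerA mulVf // scale1r.
have [eps tst] : exists eps, star t = eps *: t.
  apply: line; rewrite ?sM ?star_homog //.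
    by rewrite -(star_evenr _ p0) tp.
  by rewrite -[p]starK -(star_evenl _ q0) qt.
have eps0 : eps != 0.
  apply: contra tn0 => /eqP eps0.
  by rewrite -[t]starK tst eps0 scale0r linear0.
pose v := star u * t.
have [d vu] : exists d, v * u = d *: t.
  apply: line; rewrite /v ?mulM ?sM //.
  - exact: homogM (homogM (star_homog u1) t0) u1.
  - by rewrite !mulrA -(star_evenr _ p0) up.
  - by rewrite -!mulrA up.
have vE : v = d *: (t * u).
  by rewrite scalerAl -vu -mulrA uu /v -mulrA tp.
have tuE : t * u = d *: v.
  have /(congr1 star) := vE; rewrite /v linearZ /= (star_evenr _ t0).
  rewrite (star_evenl _ t0) starK tst -scalerAl -scalerAr => /(congr1 ( *:%R eps^-1)).
  by rewrite !scalerA mulrAC mulVf // scale1r mul1r.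
have d2 : star u * star u * t = t.
  rewrite -mulrA -/v vE -scalerAr mulrA -/v vE -scalerAl scalerA -mulrA uu tp.
  have tun0 : t * u != 0.
    by apply: contra tn0 => /eqP tu; rewrite -tp -uu mulrA tu mul0r.
  have: (d * d - 1) *: (t * u) = 0.
    by rewrite scalerBl scale1r -scalerA -vE -tuE subrr.
  by move/eqP; rewrite scaler_eq0 (negPf tun0) orbF subr_eq0 => /eqP ->; rewrite scale1r.
have : star u * star u = - q.
  by rewrite /q -uu (starM u1 u1) opprK.
move/(congr1 ( *%R^~ t)); rewrite d2 mulNr qt => /eqP; rewrite -addr_eq0 -mulr2n.
by rewrite -scaler_nat scaler_eq0 (negPf two_neq0) (negPf tn0).
Qed.

(** An eigenvector [u] of [x] with [T = u a] passes its eigenvalue on to [T]. *)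
Lemma scalar_on x T (U : {vspace A}) : T \in U -> T != 0 ->
  (forall u, u \in U -> x * u \in U) ->
  (forall u, u \in U -> u != 0 -> T \in right_ideal u) ->
  exists c, x * T = c *: T.
Proof.
move=> TU Tn0 xU gen; have [c [u [uU un0 xu]]] := eigenvector xU TU Tn0.
have /right_idealP[a ->] := gen u uU un0.
by exists c; rewrite mulrA xu scalerAl.
Qed.

(** A nonzero odd [u] in the corner would have [u^2 = d p] with [d != 0], since
    [p = u w] and [u^2 = 0] would give [u = u p = 0]; rescaling [u] to square to
    [p] contradicts [odd_square_one_false]. *)
Lemma corner_scalar M p : star_subalgebra M -> graded_prime M ->
  p \in M -> p \in G false -> p * p = p -> p != 0 ->
  (forall x, x \in M -> x \in G false -> exists c, p * x * p = c *: p) ->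
  (forall u, u \in M -> u \in G true -> p * u = u -> u * p = u -> u != 0 ->
     p \in right_ideal u) ->
  forall x, x \in M -> exists c, p * x * p = c *: p.
Proof.
move=> subM primeM pM p0 pp pn0 pM0p gen x xM.
have [/gradedP gM mulM _] := subM.
have pM1p y : y \in M -> y \in G true -> p * y * p = 0.
  move=> yM y1; apply/eqP/negPn/negP; set u := p * y * p => un0.
  have uM : u \in M by rewrite !mulM.
  have u1 : u \in G true by exact: homogM (homogM p0 y1) p0.
  have pu : p * u = u by rewrite /u !mulrA pp.
  have up : u * p = u by rewrite /u -mulrA pp.
  have [d] := pM0p _ (mulM _ _ uM uM) (homogM u1 u1).
  rewrite mulrA pu -mulrA up => uu.
  have dn0 : d != 0.
    apply/eqP=> d0; rewrite d0 scale0r in uu.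
    have /right_idealP[w pE] : p \in right_ideal u by apply: gen.
    by case/negP: un0; rewrite -up pE mulrA uu mul0r.
  have [k kk] := closed_sqrt d.
  have kn0 : k != 0 by apply: contra dn0 => /eqP k0; rewrite -kk k0 mul0r.
  apply: (@odd_square_one_false M p (k^-1 *: u)) => //.
  - exact: memvZ.
  - exact: memvZ.
  - by rewrite -scalerAr pu.
  - by rewrite -scalerAl up.
  by rewrite -scalerAl -scalerAr uu !scalerA -kk -invfM mulVf ?mulf_neq0 // scale1r.
have [d pxp] := pM0p _ (gM false _ xM) (mem_part false x).
exists d; rewrite -{1}(part_sum x) mulrDr mulrDl pxp.
by rewrite pM1p ?gM ?mem_part // addr0.
Qed.

(** * Graded simplicity *)

Hypothesis simpleA : simple_superalgebra G *%R {:A}%VS.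

(** The elements [y x z] span a nonzero graded ideal, hence all of [A]. *)
Lemma two_sided_ind a x (P : A -> Prop) : lin_closed P -> x \in G a -> x != 0 ->
  (forall y z, P (y * x * z)) -> forall z, P z.
Proof.
move=> linP xa xn0 Pyz z.
have P3 y : y \in ({:A} * <[x]> * {:A})%VS -> P y.
  by move: y; apply: prodv3_ind => // y w _ _.
case: simpleA => _ /(_ ({:A} * <[x]> * {:A})%VS)[].
- split; first exact: subvf.
    exact: graded_prodv (graded_prodv gradedf (graded_line xa)) gradedf.
  move=> y w _ wI; split; move: w wI; apply: prodv3_ind => [|u v _ _].
  + by lin_tac.
  + by rewrite !mulrA !memv_mul ?memvf ?memv_line.
  + by lin_tac.
  by rewrite -mulrA !memv_mul ?memvf ?memv_line.
- move=> I0; case/eqP: xn0; apply/eqP; rewrite -memv0 -I0.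
  have: 1 * x * 1 \in ({:A} * <[x]> * {:A})%VS.
    by apply: memv_mul (memv_mul _ (memv_line x)) _; apply: memvf.
  by rewrite mul1r mulr1.
by move=> IA; apply: P3; rewrite IA memvf.
Qed.

Lemma prime_homog a b x y : x \in G a -> y \in G b -> x != 0 -> y != 0 ->
  exists c z, z \in G c /\ x * z * y != 0.
Proof.
move=> xa yb xn0 yn0; apply: NNPP => none.
have xzy : forall z, x * z * y = 0.
  apply: homog_ind => [|c z zc]; first by lin_tac.
  by apply/eqP/negPn/negP=> nz; apply: none; exists c, z.
case/eqP: xn0; rewrite -[x]mulr1; move: (1 : A).
apply: (two_sided_ind _ yb yn0) => [|z w]; first by lin_tac.
by rewrite !mulrA xzy mul0r.
Qed.

(** If every nonzero homogeneous element of [k A] generates [k A], then [k A k] is a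
    graded division algebra; its even part is [F k] by [scalar_on], its odd part
    is [0] by [corner_scalar]. *)
Lemma generated_corner_scalar k : even_idempotent G k -> k != 0 ->
  (forall a u, u \in G a -> k * u = u -> u != 0 -> k \in right_ideal u) ->
  forall x, exists c, k * x * k = c *: k.
Proof.
move=> [k0 kk] kn0 gen x; apply: (@corner_scalar {:A}%VS) (memvf x); rewrite ?memvf //.
- by split=> *; rewrite ?memvf //; apply: gradedf.
- move=> a b u v _ _ ua vb un0 vn0.
  have [c [z [zc nz]]] := prime_homog ua vb un0 vn0.
  by exists c, z; rewrite memvf.
- move=> {}x _ x0.
  suff: exists c, k * x * k * k = c *: k by rewrite -mulrA kk.
  apply: (@scalar_on _ _ (right_ideal k :&: G false)%VS) => // [|u|u].
  + by rewrite memv_cap k0 andbT; apply/right_idealP; exists 1; rewrite mulr1.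
  + rewrite !memv_cap => /andP[_ u0]; apply/andP; split.
      by apply/right_idealP; exists (x * k * u); rewrite !mulrA.
    exact: homogM (homogM (homogM k0 x0) k0) u0.
  by move/memv_capP; rewrite right_ideal_idem // => -[/eqP ku u0]; apply: gen u0 ku.
by move=> u _ u1 ku _ un0; apply: gen u1 ku un0.
Qed.

(** * Irreducible subalgebras *)

Section Irreducible.

Variables (M : {vspace A}) (e : A).
Hypotheses (subM : star_subalgebra M) (e0 : e \in G false) (ee : e * e = e).
Hypotheses (se : star e = e) (en0 : e != 0) (eM : e \in M).
Hypothesis (Me : forall x, x \in M -> e * x = x /\ x * e = x).
Hypothesis irrM : forall a x, x \in G a -> e * x = x -> x != 0 ->
  e \in (M * <[x]> * {:A})%VS.

Let gM : forall a x, x \in M -> part a x \in M.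
Proof. by case: subM => /gradedP. Qed.

Let mulM x y : x \in M -> y \in M -> x * y \in M.
Proof. by case: subM => _ + _; apply. Qed.

Let sM x : x \in M -> star x \in M.
Proof. by case: subM => _ _; apply. Qed.

Lemma irr_ind a x (P : A -> Prop) : x \in G a -> e * x = x -> x != 0 ->
  lin_closed P -> (forall m y, m \in M -> P (m * x * y)) -> P e.
Proof.
move=> xa ex xn0 linP Pm; have := irrM xa ex xn0; move: e.
by apply: prodv3_ind => // u v /Pm.
Qed.

(** If [x M y = 0], then [x] annihilates [M y A], which contains [e]. *)
Lemma irr_prime : graded_prime M.
Proof.
move=> a b x y xM yM xa yb xn0 yn0; apply: NNPP => none.
have xzy z : z \in M -> x * z * y = 0.
  move=> zM; rewrite -(part_sum z) mulrDr mulrDl.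
  suff H c : x * part c z * y = 0 by rewrite !H addr0.
  apply/eqP/negPn/negP => xzyn0; apply: none; exists c, (part c z).
  by rewrite gM ?mem_part.
have [_ xe] := Me xM; have [ey _] := Me yM.
case/eqP: xn0; rewrite -xe; apply: (@irr_ind b y (fun z => x * z = 0) yb ey yn0) => [|m z mM].
  by lin_tac.
by rewrite !mulrA xzy // mul0r.
Qed.

Let homogeneous T := [/\ T \in M, T != 0 & exists a, T \in G a].
Let rank (T : A) := \dim (right_ideal T).
Let min_rank T := homogeneous T /\ forall X, homogeneous X -> (rank T <= rank X)%N.

Let right_idealS (T X : A) : X \in right_ideal T -> (right_ideal X <= right_ideal T)%VS.
Proof.
case/right_idealP=> w ->; apply/subvP=> y /right_idealP[z ->].
by apply/right_idealP; exists (w * z); rewrite mulrA.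
Qed.

Let min_rank_gen (T X : A) : min_rank T -> homogeneous X -> X \in right_ideal T ->
  T \in right_ideal X.
Proof.
move=> [_ minT] hX XT; have sub := right_idealS XT.
have /eqP -> : right_ideal X == right_ideal T by rewrite eqEdim sub; apply: minT.
by apply/right_idealP; exists 1; rewrite mulr1.
Qed.

(** All nonzero elements of [T A] homogeneous of the degree of [T] and lying in
    [M] generate [T A], by minimality of the rank. *)
Let min_rank_scalar a (T S : A) : min_rank T -> T \in G a -> S \in M -> S \in G a ->
  exists c, T * S * T = c *: T.
Proof.
move=> mT Ta SM Sa; have [[TM Tn0 _] _] := mT.
apply: (@scalar_on _ _ (M :&: G a :&: right_ideal T)%VS) => //.
- by rewrite !memv_cap TM Ta; apply/right_idealP; exists 1; rewrite mulr1.
- move=> u; rewrite !memv_cap => /andP[/andP[uM ua] _].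
  rewrite !mulM //=; apply/andP; split; last first.
    by apply/right_idealP; exists (S * u); rewrite mulrA.
  by have := homogM (homogM Ta Sa) ua; rewrite addbb.
move=> u; rewrite !memv_cap => /andP[/andP[uM ua] uT] un0.
by apply: min_rank_gen uT => //; split=> //; exists a.
Qed.

(** A minimal rank [T] and an [S] of the same degree with [T S T != 0] satisfy
    [T S T = c T], and [c^-1 T S] is the idempotent. *)
Lemma primitive_idempotent : exists p,
  [/\ p \in M, p \in G false, p * p = p, p != 0
    & forall x, x \in M -> exists c, p * x * p = c *: p].
Proof.
have [T0 hT0 minT0] : exists2 T, homogeneous T &
    forall X, homogeneous X -> (rank T <= rank X)%N.
  by apply: ex_minimal; exists e; split=> //; exists false.
have [T [S [a [mT Ta [SM Sa] TSTn0]]]] : exists T S a,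
    [/\ min_rank T, T \in G a, S \in M /\ S \in G a & T * S * T != 0].
  have [TM Tn0 [a Ta]] := hT0.
  case: (classic (exists S, [/\ S \in M, S \in G a & T0 * S * T0 != 0])).
    by case=> S [SM Sa nz]; exists T0, S, a.
  move=> none.
  (* Otherwise T0 z T0 is nonzero only for z of the opposite degree; the element
     T0 z T0 then has that degree and is again of minimal rank. *)
  have [b [z [zM zb nz]]] := irr_prime TM TM Ta Ta Tn0 Tn0.
  have bE : b = ~~ a.
    case: (eqVneq b a) => [ba|]; last by case: (a) (b) => [] [].
    by case: none; exists z; rewrite -ba.
  rewrite {b}bE in zb; pose T := T0 * z * T0.
  have Tna : T \in G (~~ a).
    by have := homogM (homogM Ta zb) Ta; rewrite addbN addbb.
  have TM' : T \in M by rewrite !mulM.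
  have mT : min_rank T.
    split; first by split=> //; exists (~~ a).
    move=> X /minT0; apply: leq_trans; apply/dimvS/right_idealS/right_idealP.
    by exists (z * T0); rewrite mulrA.
  have [b [w [wM wb nzw]]] := irr_prime TM' TM' Tna Tna nz nz.
  exists T, w, (~~ a); split=> //; split=> //.
  case: (eqVneq b (~~ a)) => [<- //|nba].
  have {nba}ba : b = a by case: (a) (b) nba => [] [].
  case/negP: nzw; apply/eqP; rewrite /T.
  have -> : T0 * z * T0 * w * (T0 * z * T0) = T0 * z * (T0 * w * T0) * z * T0.
    by rewrite !mulrA.
  have -> : T0 * w * T0 = 0; last by rewrite mulr0 !mul0r.
  apply/eqP/negPn/negP=> nz0; apply: none; exists w; split=> //; by rewrite -ba.
have [c TST] := min_rank_scalar mT Ta SM Sa.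
have cn0 : c != 0 by apply: contra TSTn0 => /eqP c0; rewrite TST c0 scale0r.
have [[TM Tn0 _] minT] := mT.
pose p := c^-1 *: (T * S).
have pT : p * T = T by rewrite -scalerAl TST scalerA mulVf // scale1r.
have pM : p \in M by rewrite memvZ ?mulM.
have p0 : p \in G false by rewrite memvZ //; have := homogM Ta Sa; rewrite addbb.
have pn0 : p != 0 by apply: contra Tn0 => /eqP p_0; rewrite -pT p_0 mul0r.
have pp : p * p = p by rewrite {2}/p -scalerAr mulrA pT.
have mp : min_rank p.
  split; first by split=> //; exists false.
  move=> X /minT; apply: leq_trans; apply/dimvS/right_idealS/right_idealP.
  by exists (c^-1 *: S); rewrite -scalerAr.
clearbody p.
have pM0p x : x \in M -> x \in G false -> exists d, p * x * p = d *: p.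
  exact: min_rank_scalar mp p0.
exists p; split=> //; apply: corner_scalar => //; first exact: irr_prime.
move=> u uM u1 pu up un0; apply: min_rank_gen => //; first by split=> //; exists true.
by apply/right_idealP; exists u.
Qed.

(** Burnside's theorem. With [p] a primitive idempotent of [M], irreducibility
    [e \in M p A] shows that [p] is primitive in [A] too and that
    [e A p = M p] lies in [M]; applying the involution, so does [p^* A e]. Finally
    [e A p M p^* A e = e A e], because [p M p^*] is nonzero and [A] is simple. *)
Lemma irreducible_full x : x \in corner e -> x \in M.
Proof.
have [p [pM p0 pp pn0 pMp]] := primitive_idempotent.
have [ep pe] := Me pM.
have genp a y : y \in G a -> p * y = y -> y != 0 -> p \in right_ideal y.
  move=> ya py yn0; rewrite -pe.
  have ey : e * y = y by rewrite -py mulrA ep.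
  apply: (@irr_ind a y (fun z => p * z \in right_ideal y)) => // [|m z mM].
    by lin_tac.
  have [c pmp] := pMp m mM.
  rewrite -py !mulrA pmp -!scalerAl memvZ //; apply/right_idealP.
  by exists z; rewrite py.
have pAp : forall y, exists c, p * y * p = c *: p.
  exact: generated_corner_scalar (conj p0 pp) pn0 genp.
have eAp y : e * y * p \in M.
  apply: (@irr_ind false p (fun z => z * y * p \in M)) => // [|m z mM].
    by lin_tac.
  have [c pzp] := pAp (z * y).
  have -> : m * p * z * y * p = m * (p * (z * y) * p) by rewrite !mulrA.
  by rewrite pzp -scalerAr memvZ // mulM.
have q0 := star_homog p0.
have qn0 : star p != 0 by rewrite -(inj_eq star_inj) starK linear0.
have [k [m [mM mk nz]]] := irr_prime pM (sM pM) p0 q0 pn0 qn0.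
have zk : p * m * star p \in G k by rewrite even_mulr // even_mull.
case/cornerP=> {}x ->; move: x.
apply: (two_sided_ind _ zk nz) => [|y w]; first by lin_tac.
have qAe : star p * w * e \in M.
  rewrite -[w]starK -se -mulrA -(star_evenl _ e0) -(star_evenr _ p0).
  by apply: sM.
have -> : e * (y * (p * m * star p) * w) * e = e * y * p * m * (star p * w * e).
  by rewrite !mulrA.
by rewrite mulM // mulM.
Qed.

End Irreducible.

(** * Right ideals and idempotents *)

Lemma homog_disjoint a b x : x \in G a -> x \in G b -> x != 0 -> a = b.
Proof.
move=> xa xb xn0; case: (eqVneq a b) => // /negPf nab; case/eqP: xn0.
by have := homog_partE b gradA xa; rewrite (homog_partE b gradA xb) eqxx eq_sym nab.
Qed.

Lemma exists_primitive : exists p,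
  [/\ p \in G false, p * p = p, p != 0 & forall x, exists c, p * x * p = c *: p].
Proof.
have unit_ideal a x : x \in G a -> 1 * x = x -> x != 0 ->
    1 \in ({:A} * <[x]> * {:A})%VS.
  move=> xa _ xn0.
  apply: (@two_sided_ind a x (fun z => z \in _) _ xa xn0) => [|y z]; first by lin_tac.
  by apply: memv_mul (memv_mul _ (memv_line x)) _; apply: memvf.
have full : star_subalgebra {:A}%VS.
  by split=> *; rewrite ?memvf //; apply: gradedf.
have [||x _|p [_ p0 pp pn0 pAp]] := primitive_idempotent full one_even _ _ _ unit_ideal.
- exact: oner_neq0.
- exact: memvf.
- by rewrite mul1r mulr1.
by exists p; split=> // x; apply/pAp/memvf.
Qed.

(** Take an even idempotent [k] of [R] with [k A] of largest dimension. A nonzero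
    homogeneous [y] of [R] with [k y = 0] would give an even idempotent
    [l] in [y A], namely [v t] with [v \in y A p] and [t v = p] primitive, and
    [k + l - l k] would generate a larger ideal. *)
Lemma right_ideal_generator (R : {vspace A}) :
  graded_subspace G R -> (forall x y, x \in R -> x * y \in R) ->
  exists k, [/\ k \in G false, k * k = k, k \in R & R = right_ideal k].
Proof.
move=> gR idR; have [p [p0 pp pn0 pAp]] := exists_primitive.
pose P k := [/\ k \in R, k \in G false & k * k = k].
have [k [kR k0 kk] maxk] : exists2 k, P k & forall l, P l ->
    (\dim {:A} - \dim (right_ideal k) <= \dim {:A} - \dim (right_ideal l))%N.
  by apply: ex_minimal; exists 0; split; rewrite ?mem0v ?mulr0.
exists k; split=> //; apply/eqP; rewrite eqEsubv andbC; apply/andP; split.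
  by apply/subvP=> _ /right_idealP[y ->]; apply: idR.
apply: contraT => /(graded_homog_notin gR)[a [x [xa xR]]].
rewrite right_ideal_idem // => kx.
pose y := x - k * x.
have yR : y \in R by rewrite memvB ?idR.
have ya : y \in G a by rewrite memvB // even_mull.
have ky : k * y = 0 by rewrite mulrBr mulrA kk subrr.
have yn0 : y != 0 by rewrite subr_eq0 eq_sym.
have [b [z [zb vn0]]] := prime_homog ya p0 yn0 pn0.
set v := y * z * p in vn0.
have vb : v \in G (a (+) b) by exact: even_mulr (homogM ya zb) p0.
have [c [s [sc nz]]] := prime_homog p0 vb pn0 vn0.
have [d] := pAp (s * (y * z)).
have -> : p * (s * (y * z)) * p = p * s * v by rewrite /v !mulrA.
move=> psv; have dn0 : d != 0 by apply: contra nz; rewrite psv => /eqP->; rewrite scale0r.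
have even_psv : p * s * v \in G false by rewrite psv memvZ.
pose t := d^-1 *: (p * s).
have tv : t * v = p by rewrite -scalerAl psv scalerA mulVf // scale1r.
have vp : v * p = v by rewrite /v -[LHS]mulrA pp.
have l0 : v * t \in G false.
  have deg : c (+) (a (+) b) = false.
    exact: homog_disjoint (homogM (even_mull p0 sc) vb) even_psv nz.
  by rewrite -scalerAr memvZ // -deg addbC; apply/(homogM vb)/even_mull.
have kv : k * v = 0 by rewrite /v !mulrA ky !mul0r.
have lv : v * t * v = v by rewrite -mulrA tv.
have lR : v * t \in R by rewrite /v -!mulrA idR.
have kl : k * (v * t) = 0 by rewrite mulrA kv mul0r.
have ll : v * t * (v * t) = v * t by rewrite mulrA lv.
clearbody v t => {psv tv}.
set l := v * t in l0 lv lR kl ll; clearbody l.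
pose m := k + l - l * k.
have mk : m * k = k.
  by rewrite /m mulrBl mulrDl kk -[_ * k * k]mulrA kk addrK.
have ml : m * l = l.
  by rewrite /m mulrBl mulrDl kl ll add0r -mulrA kl mulr0 subr0.
have Pm : P m.
  split; last by rewrite {2}/m mulrBr mulrDr mk ml mulrA ml.
    by rewrite memvB ?memvD ?idR.
  by rewrite memvB ?memvD //; apply: even_mulr.
have mm : m * m = m by case: Pm.
have := maxk m Pm; rewrite leqNgt => /negP[]; apply: ltn_sub2l; last first.
  have sub : (right_ideal k <= right_ideal m)%VS.
    apply/subvP=> w; rewrite !right_ideal_idem // => /eqP <-.
    by rewrite mulrA mk.
  rewrite ltn_neqAle dimvS // andbT; have [_ ->] := dimv_leqif_sup sub.
  apply/subvPn; exists l; rewrite right_ideal_idem ?ml ?kl //.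
  by apply: contra vn0 => /eqP l_0; rewrite -lv -l_0 mul0r.
rewrite ltn_neqAle dimvS ?subvf // andbT.
have [_ ->] := dimv_leqif_sup (subvf (right_ideal k)).
by apply/subvPn; exists x; rewrite ?memvf // right_ideal_idem.
Qed.

Lemma even_star_idem e : even_idempotent G e -> even_idempotent G (star e).
Proof.
by case=> e0 ee; split; [apply: star_homog | rewrite -(star_evenl _ e0) ee].
Qed.

Lemma star_corner e x f : e \in G false -> f \in G false ->
  star (e * x * f) = star f * star x * star e.
Proof. by move=> e0 f0; rewrite (star_evenr _ f0) (star_evenl _ e0) mulrA. Qed.

(** An isotropic idempotent can be made orthogonal to its adjoint without changing
    its right ideal: [r = k - k k^* / 2]. *)
Lemma isotropic_idempotent k : even_idempotent G k -> star k * k = 0 ->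
  exists r, [/\ even_idempotent G r, star r * r = 0 & r * star r = 0] /\
    [/\ k * r = r, r * k = k & r + star r = k + star k - k * star k].
Proof.
move=> [k0 kk] skk; pose w := k * star k; pose s : F := 2%:R^-1.
have sk0 := star_homog k0; have [_ sksk] := even_star_idem (conj k0 kk).
have w0 : w \in G false by apply: even_mull.
have sw : star w = w by rewrite star_evenl // starK.
have kw : k * w = w by rewrite mulrA kk.
have wk : w * k = 0 by rewrite -mulrA skk mulr0.
have skw : star k * w = 0 by rewrite mulrA skk mul0r.
have wsk : w * star k = w by rewrite -mulrA sksk.
have ww : w * w = 0 by rewrite {2}/w mulrA wk mul0r.
have ss : s *: w + s *: w = w.
  by rewrite -scalerDl -mulr2n -mulr_natl divff // scale1r.
pose r := k - s *: w.
have sr : star r = star k - s *: w by rewrite /r linearB linearZ /= sw.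
have wr : w * r = 0 by rewrite mulrBr wk -scalerAr ww scaler0 subrr.
exists r; split; split.
- split; first by rewrite memvB ?memvZ.
  by rewrite {1}/r mulrBl -scalerAl wr scaler0 subr0 mulrBr kk -scalerAr kw.
- by rewrite sr mulrBl -scalerAl wr scaler0 subr0 mulrBr skk -scalerAr skw scaler0 subrr.
- rewrite sr mulrBr -scalerAr /r !mulrBl -!scalerAl wsk kw ww scaler0 subr0 -/w.
  by apply/eqP; rewrite subr_eq0 subr_eq ss.
- by rewrite mulrBr kk -scalerAr kw.
- by rewrite mulrBl kk -scalerAl wk scaler0 subr0.
by rewrite sr -/w /r addrACA -opprD ss.
Qed.

Lemma homog_annihilator a b x y : x \in G a -> y \in G b -> y != 0 ->
  (forall z, x * z * y = 0) -> x = 0.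
Proof.
move=> xa yb yn0 xzy; apply/eqP/negPn/negP=> xn0.
by have [c [z [_ /negP[]]]] := prime_homog xa yb xn0 yn0; rewrite xzy.
Qed.

Lemma graded_corner e : e \in G false -> graded_subspace G (corner e).
Proof.
move=> e0; have gl := graded_line e0.
exact: graded_prodv (graded_prodv gl gradedf) gl.
Qed.

Lemma star_in_corner e x : e \in G false -> star e = e ->
  x \in corner e -> star x \in corner e.
Proof.
by move=> e0 se /cornerP[y ->]; rewrite star_corner // se; apply/cornerP; exists (star y).
Qed.

Lemma cornerM (e x y : A) : x \in corner e -> y \in corner e -> x * y \in corner e.
Proof.
move=> /cornerP[a ->] /cornerP[b ->]; apply/cornerP.
by exists (a * e * e * b); rewrite !mulrA.
Qed.

Lemma gen_alg_herm_star_subalgebra (C : {vspace A}) : graded_subspace G C ->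
  star_subalgebra (gen_alg (herm_elts star C)).
Proof.
move=> gC; have gH := graded_herm gC; split; first exact: graded_gen_alg.
  by have [_ /prodvP mul _] := gen_alg_spec (herm_elts star C).
by apply: gen_alg_star => // x /hermP[xC sx]; rewrite sx; apply/hermP.
Qed.

Lemma trace_herm (C : {vspace A}) x : (forall y, y \in C -> star y \in C) ->
  x \in C -> trace x \in herm_elts star C.
Proof.
by move=> sC xC; apply/hermP; split; [rewrite traceE memvD ?sC | apply: star_trace].
Qed.

(** By [irreducible_full] the Hermitian elements stabilize a proper right ideal
    [k A] of [e A], that is [l h k = 0] with [l = e - k]. For [h = trace (z l)]
    and [h = trace (z k^* )] this gives [l l^* = 0] and [k^* k = 0]: the ideal
    is its own orthogonal. *)
Lemma hyperbolic_split e : even_idempotent G e -> star e = e ->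
  gen_alg (herm_elts star (corner e)) <> corner e ->
  exists k, [/\ even_idempotent G k, k != 0, star k * k = 0, k * star k = 0 &
    k + star k = e /\
    forall h, h \in herm_elts star (corner e) -> star k * h * k = 0].
Proof.
move=> [e0 ee] se; set S := herm_elts _ _; set M := gen_alg S => Mne.
have gC := graded_corner e0.
have [gM mulM sM] : star_subalgebra M by apply: gen_alg_herm_star_subalgebra.
have [/subvP SM _ minM] := gen_alg_spec S.
have MC : (M <= corner e)%VS.
  by apply: minM; [apply: capvSl | apply/prodvP=> *; apply: cornerM].
have /subvPn[x xC xM] : ~~ (corner e <= M)%VS.
  by apply/negP=> CM; apply: Mne; apply/eqP; rewrite eqEsubv MC.
have eC : e \in corner e by apply/(corner_idem _ ee).
have eM : e \in M by apply/SM/hermP.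
have Me y : y \in M -> e * y = y /\ y * e = y.
  by move=> /(subvP MC)/(corner_idem _ ee).
have en0 : e != 0.
  apply: contra xM => /eqP e_0; case/cornerP: xC => y ->.
  by rewrite e_0 mulr0 mem0v.
have [a [y [ya ey yn0 eMyA]]] : exists a y, [/\ y \in G a, e * y = y, y != 0
    & e \notin (M * <[y]> * {:A})%VS].
  apply: NNPP => none; case/negP: xM; apply: (@irreducible_full M e) xC => // a y ya ey yn0.
  by apply: contraT => eMyA; case: none; exists a, y.
set R := (M * <[y]> * {:A})%VS in eMyA.
have idR r z : r \in R -> r * z \in R.
  move: r; apply: prodv_ind => [|u v uU _]; first by lin_tac.
  by rewrite -mulrA memv_mul ?memvf.
have MR m r : m \in M -> r \in R -> m * r \in R.
  move=> mM; move: r; apply: prodv3_ind => [|u v uM _]; first by lin_tac.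
  rewrite !mulrA; exact: memv_mul (memv_mul (mulM _ _ mM uM) (memv_line y)) (memvf v).
have eR r : r \in R -> e * r = r.
  move: r; apply: prodv3_ind => [|u v uM _]; first by lin_tac.
  by rewrite !mulrA; case: (Me u uM) => ->.
have yR : y \in R by have := memv_mul (memv_mul eM (memv_line y)) (memvf 1); rewrite ey mulr1.
have [k1 [k10 kk1 k1R RE]] : exists k, [/\ k \in G false, k * k = k, k \in R & R = right_ideal k].
  apply: right_ideal_generator => //.
  exact: graded_prodv (graded_prodv gM (graded_line ya)) gradedf.
have ek1 := eR _ k1R.
pose k := k1 * e.
have k0 : k \in G false by apply: even_mull.
have kk1k : k * k1 = k1 by rewrite -mulrA ek1.
have kk : k * k = k by rewrite {2}/k mulrA kk1k.
have kR : k \in R by apply: idR.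
have kRid r : r \in R -> k * r = r.
  by rewrite RE right_ideal_idem // => /eqP <-; rewrite mulrA kk1k.
have kn0 : k != 0.
  by apply: contra yn0 => /eqP k_0; rewrite -(kRid _ yR) k_0 mul0r.
have ek : e * k = k by apply: eR.
have ke : k * e = k by rewrite -mulrA ee.
clearbody k => {k1R ek1 kk1k kk1 k10 RE k1}.
pose l := e - k; have l0 : l \in G false by rewrite memvB.
have ln0 : l != 0 by apply: contra eMyA; rewrite subr_eq0 => /eqP ->.
have le : l * e = l by rewrite mulrBl ee ke.
have lk : l * k = 0 by rewrite mulrBl ek kk subrr.
have lhk h : h \in S -> l * h * k = 0.
  move=> /SM hM; have [eh _] := Me h hM.
  by rewrite mulrBl eh mulrBl -[k * h * k]mulrA kRid ?MR ?subrr.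
have trS z : trace (e * z * e) \in S.
  apply: trace_herm => [w|]; first exact: star_in_corner.
  by apply/cornerP; exists z.
have [sk0 sl0] := (star_homog k0, star_homog l0).
have sle : star l * e = star l.
  by rewrite -{1}se -(star_evenl _ e0) mulrBr ee ek.
have ske : star k * e = star k by rewrite -{1}se -(star_evenl _ e0) ek.
have esk : e * star k = star k by rewrite -{1}se -(star_evenr _ e0) ke.
have esl : e * star l = star l by rewrite -{1}se -(star_evenr _ e0) le.
have sksl : star k * star l = 0 by rewrite -(star_evenl _ l0) lk linear0.
(* In l h k with h the trace of e z^* l e, the summand l z^* l k vanishes and
   l l^* z k remains; the same is done for k^* k with the adjoint of lhk. *)
have lsl : l * star l = 0.
  apply: (@homog_annihilator false false _ k) => // [|z]; first exact: even_mull.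
  have := lhk _ (trS (star z * l)).
  rewrite !traceE mulrDr mulrDl star_corner // star_evenr // starK se.
  rewrite !mulrA le -[X in X + _]mulrA ek -[X in X + _]mulrA lk mulr0 add0r.
  by rewrite -[_ * e * k]mulrA ek.
have skk : star k * k = 0.
  apply: (@homog_annihilator false false _ (star l)) => // [||z].
  - exact: even_mull.
  - by rewrite -(inj_eq star_inj) starK linear0.
  have skhl h : h \in S -> star k * h * star l = 0.
    move=> hS; have /(congr1 star) := lhk h hS.
    by rewrite star_corner // linear0; case/hermP: hS => _ ->.
  have := skhl _ (trS (star z * star k)).
  rewrite !traceE mulrDr mulrDl star_corner // star_evenr // !starK se.
  rewrite !mulrA ske -[X in X + _]mulrA esl -[X in X + _]mulrA sksl mulr0 add0r.
  by rewrite -[_ * e * star l]mulrA esl.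
have eE : k + star k - k * star k = e.
  have slE : star l = e - star k by rewrite /l linearB /= se.
  have lsk : l * star k = star k - k * star k by rewrite /l mulrBl esk.
  move/eqP: lsl; rewrite slE mulrBr le lsk subr_eq0 => /eqP lE.
  by rewrite -[RHS](subrK k) -/l lE [RHS]addrC addrA.
have skl : star k * l = star k by rewrite mulrBr ske skk subr0.
have [r [[er srr rsr] [kr rk rE]]] := isotropic_idempotent (conj k0 kk) skk.
have rn0 : r != 0 by apply: contra kn0 => /eqP r_0; rewrite -rk r_0 mul0r.
exists r; split=> //; split; first by rewrite rE eE.
move=> h hS; rewrite -kr (star_evenl _ k0) !mulrA.
have -> : star r * star k * h * k * r = star r * (star k * (l * h * k)) * r.
  by rewrite !mulrA -[_ * star k * l]mulrA skl.
by rewrite lhk // !mulr0 mul0r.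
Qed.

(** A right ideal inside [k A] is generated by an even idempotent [m], and [m k]
    is an idempotent of [k A k] with the same right ideal, hence equal to [k]. *)
Lemma minimal_corner_scalar k : even_idempotent G k -> k != 0 ->
  (forall m, even_idempotent G m -> k * m = m -> m * k = m -> m != 0 -> m = k) ->
  forall x, exists c, k * x * k = c *: k.
Proof.
move=> [k0 kk] kn0 mink; apply: generated_corner_scalar => // a u ua ku un0.
have gR : graded_subspace G (right_ideal u).
  exact: graded_prodv (graded_line ua) gradedf.
have idR x y : x \in right_ideal u -> x * y \in right_ideal u.
  by case/right_idealP=> z ->; apply/right_idealP; exists (z * y); rewrite mulrA.
have [m [m0 mm mu uE]] := right_ideal_generator gR idR.
have km : k * m = m by case/right_idealP: mu => z ->; rewrite mulrA ku.
have mkm : m * k * m = m by rewrite -mulrA km mm.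
have mn0 : m != 0.
  apply: contra un0 => /eqP m_0; have : u \in right_ideal u.
    by apply/right_idealP; exists 1; rewrite mulr1.
  by rewrite uE m_0 right_ideal_idem ?mulr0 // mul0r eq_sym.
rewrite -(mink (m * k)); first exact: idR.
- by split; [apply: even_mull | rewrite mulrA mkm].
- by rewrite mulrA km.
- by rewrite -mulrA kk.
by apply: contra mn0 => /eqP mk; rewrite -mkm mk mul0r.
Qed.

Lemma corner1 : corner (1 : A) = {:A}%VS.
Proof.
by apply/vspaceP=> x; rewrite memvf; apply/cornerP; exists x; rewrite mul1r mulr1.
Qed.

(** * Generation by Hermitian elements *)

(** Otherwise [1 = k + k^*] with every element of [k^* A k] skew. If [m] is an
    idempotent of [k A k], then [m^* z (k - m)] is skew while its adjoint is killed
    on the left by [m^*], so it is [0] and [m = k] or [m = 0]. Thus [k A k] is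
    [F k], the space [k A k^*] is a line [F w], and a Hermitian element, having no
    component in [k^* A k], lies in the span of [1] and [w]. *)
Lemma gen_alg_hermf : (2 < \dim (herm_elts star {:A}))%N ->
  gen_alg (herm_elts star {:A}) = {:A}%VS.
Proof.
set J := herm_elts _ _ => dimJ; apply: NNPP => nJ.
have [|k [[k0 kk] kn0 skk ksk [k1 kJk]]] := hyperbolic_split (conj one_even (mulr1 1)) star1.
  by rewrite corner1.
rewrite corner1 -/J in kJk.
have [sk0 sksk] := even_star_idem (conj k0 kk).
have skew x : star (star k * x * k) = - (star k * x * k).
  apply/eqP; rewrite -addr_eq0 star_corner // starK -mulrDl -mulrDr addrC.
  by rewrite -traceE kJk // /J; apply: trace_herm => *; rewrite memvf.
have skn0 : star k != 0 by rewrite -(inj_eq star_inj) starK linear0.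
have kAk : forall x, exists c, k * x * k = c *: k.
  apply: minimal_corner_scalar => // m [m0 mm] km mk mn0.
  have l0 : k - m \in G false by rewrite memvB.
  have sm0 := star_homog m0; have [_ smsm] := even_star_idem (conj m0 mm).
  apply/esym/eqP; rewrite -subr_eq0; apply: contraT => ln0.
  case/eqP: mn0; apply: star_inj; rewrite linear0.
  apply: (homog_annihilator sm0 l0 ln0) => z.
  have <- : star k * (star m * z * (k - m)) * k = star m * z * (k - m).
    by rewrite !mulrA -(star_evenl _ m0) mk -mulrA mulrBl kk mk.
  have := skew (star m * z * (k - m)).
  have -> : star k * (star m * z * (k - m)) * k = star m * z * (k - m).
    by rewrite !mulrA -(star_evenl _ m0) mk -mulrA mulrBl kk mk.
  rewrite star_corner // starK => /(congr1 ( *%R (star m))).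
  rewrite !mulrA -(star_evenl _ l0) mulrBl km mm subrr linear0 !mul0r mulrN.
  by rewrite !mulrA smsm => /esym/eqP; rewrite oppr_eq0 => /eqP.
have skAsk x : exists c, star k * x * star k = c *: star k.
  have [c kxk] := kAk (star x); exists c.
  by rewrite -[x]starK -star_corner // kxk linearZ.
have [a [y [ya nz]]] := prime_homog sk0 k0 skn0 kn0.
have ska : star k * y * k \in G a by rewrite even_mulr // even_mull.
have [b [d [db nz2]]] := prime_homog ska sk0 nz skn0.
have [c] := skAsk (y * k * d); rewrite !mulrA => xd.
have cn0 : c != 0 by apply: contra nz2 => /eqP c0; rewrite xd c0 scale0r.
pose w := c^-1 *: (k * d * star k).
have xw : star k * y * k * w = star k.
  rewrite /w -scalerAr !mulrA -[_ * k * k]mulrA kk xd scalerA mulVf //.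
  exact: scale1r.
have sub : (J <= <[1]> + <[w]>)%VS.
  apply/subvP=> h hJ; have [_ sh] := hermP _ _ hJ.
  have [l kh] := kAk h; have [m khm] := kAk (h * star k * y).
  have skh : star k * h * star k = l *: star k.
    by rewrite -{1}sh -star_corner // kh linearZ.
  have khsk : k * h * star k = m *: w.
    have kw : k * w = w by rewrite /w -scalerAr !mulrA kk.
    have -> : k * h * star k = k * (h * star k * y) * k * w.
      by rewrite -[in LHS]xw !mulrA.
    by rewrite khm -scalerAl kw.
  have -> : h = l *: 1 + m *: w.
    rewrite -{1}[h]mul1r -[1 * h]mulr1 -k1 !mulrDl !mulrDr kh khsk skh.
    by rewrite kJk // add0r scalerDr addrAC.
  by apply: memv_add; apply: memvZ; apply: memv_line.
have := leq_trans dimJ (dimvS sub); rewrite ltnNge => /negP[].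
apply: leq_trans (dimv_add_leqif _ _) _.
by rewrite !dim_vline; case: (_ != 0) (_ != 0) => [] [].
Qed.

(** * Stabilizers of right ideals *)

Lemma part_evenl a e x : e \in G false -> part a (e * x) = e * part a x.
Proof.
move=> e0; rewrite part_mul (homog_partE _ gradA e0) /=.
by rewrite (homog_partE _ gradA e0) /= mul0r addr0.
Qed.

Lemma part_evenr a e x : e \in G false -> part a (x * e) = part a x * e.
Proof.
move=> e0; apply: star_inj; rewrite -star_part !(star_evenr _ e0).
by rewrite part_evenl ?star_part // star_homog.
Qed.

(** The elements stabilizing the right ideal [e A] and its orthogonal
    [(1 - e^* ) A]. *)
Definition stab e : {vspace A} :=
  (lker (amulr e \o amull (1 - e)) :&:
   lker (amulr (1 - star e) \o amull (star e)))%VS.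

Lemma stabP e x :
  reflect (e * x * e = x * e /\ star e * x * star e = star e * x) (x \in stab e).
Proof.
rewrite memv_cap !memv_ker !comp_lfunE /amull /amulr !lfunE /=.
rewrite !mulrBl mulrBr mul1r !mulr1 !subr_eq0.
by apply: (iffP andP) => -[] => [/eqP-> /eqP<-|-> ->].
Qed.

Lemma stab_herm e x : even_idempotent G e -> star x = x ->
  e * x * e = x * e -> x \in stab e.
Proof.
move=> [e0 ee] sx exe; apply/stabP; split=> //.
have /(congr1 star) := exe.
by rewrite star_corner // (star_evenr _ e0) sx.
Qed.

Lemma stab_star_subalgebra e : even_idempotent G e -> star_subalgebra (stab e).
Proof.
move=> [e0 ee]; have se0 := star_homog e0; split.
- apply/gradedP=> a x /stabP[xe ex]; apply/stabP.
  by rewrite -!(part_evenr _ _ e0, part_evenl _ _ e0, part_evenr _ _ se0,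
                part_evenl _ _ se0) xe ex.
- move=> x y /stabP[xe ex] /stabP[ye ey]; apply/stabP; split.
    have xye : x * y * e = x * e * y * e by rewrite -[LHS]mulrA -ye !mulrA.
    by rewrite -[LHS]mulrA xye !mulrA xe.
  have exy : star e * (x * y) = star e * x * (star e * y).
    by rewrite [LHS]mulrA -[in LHS]ex !mulrA.
  by rewrite exy -mulrA ey.
move=> x /stabP[xe ex]; apply/stabP; split.
  have /(congr1 star) := ex; rewrite star_corner // (star_evenl _ se0).
  by rewrite !starK.
have /(congr1 star) := xe; rewrite star_corner // (star_evenr _ e0).
by [].
Qed.

Lemma stab_proper e : even_idempotent G e -> e != 0 -> e != 1 -> stab e <> {:A}%VS.
Proof.
move=> [e0 ee] en0 en1 stabA.
have f0 : 1 - e \in G false by rewrite memvB ?one_even.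
case/negP: en1; rewrite eq_sym -subr_eq0; apply/eqP.
apply: (homog_annihilator f0 e0 en0) => z.
have /stabP[ze _] : z \in stab e by rewrite stabA memvf.
by rewrite !mulrBl ze mul1r subrr.
Qed.

(** Lets an identity on a product of two factors rewrite inside a left-associated
    product. *)
Lemma mulA_eq (u v w : A) : u * v = w -> forall x, x * u * v = x * w.
Proof. by move=> <- x; rewrite mulrA. Qed.

(** * Maximal subalgebras from stabilizers *)

Section Maximal.

Local Notation J := (herm_elts star {:A}%VS).

Hypothesis genJ : gen_alg J = {:A}%VS.

Lemma maximal_herm (B M : {vspace A}) : maximal_subalgebra G (jordan_mul G) J B ->
  star_subalgebra M -> M <> {:A}%VS -> (B <= M)%VS -> B = herm_elts star M.
Proof.
move=> [[BJ gB _] _ maxB] [gM mulM sM] Mn BM.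
have mulMv : (M * M <= M)%VS by apply/prodvP=> *; apply: mulM.
symmetry; apply: maxB.
- exact: herm_jordan.
- move=> HJ; apply: Mn; apply/eqP; rewrite eqEsubv subvf -genJ.
  have [_ _ minJ] := gen_alg_spec J; apply: minJ => //.
  by rewrite -HJ capvSl.
by apply/subvP=> x xB; apply/hermP; have /hermP[_ sx] := subvP BJ x xB;
  rewrite (subvP BM).
Qed.

Lemma levi_commute e x : e * e = e ->
  reflect (e * x = x * e) (x \in (corner e + corner (1 - e))%VS).
Proof.
move=> ee; have ef : e * (1 - e) = 0 by rewrite mulrBr mulr1 ee subrr.
have fe : (1 - e) * e = 0 by rewrite mulrBl mul1r ee subrr.
apply: (iffP memv_addP) => [[_ /cornerP[y ->] [_ /cornerP[z ->] ->]]|ex].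
  move: (1 - e) ef fe => f ef fe.
  by rewrite mulrDr mulrDl !mulrA ef ee (mulA_eq ee) (mulA_eq fe) !mul0r mulr0 !addr0.
exists (e * x * e); first by apply/cornerP; exists x.
exists ((1 - e) * x * (1 - e)); first by apply/cornerP; exists x.
rewrite mulrBr mulr1 !mulrBl !mul1r ex (mulA_eq ee) subrr subr0.
by rewrite addrC subrK.
Qed.

Lemma levi_star_subalgebra e : even_idempotent G e -> star e = e ->
  star_subalgebra (corner e + corner (1 - e))%VS.
Proof.
move=> [e0 ee] se; split.
- by apply: graded_addv; apply: graded_corner; rewrite // memvB ?one_even.
- move=> x y /(levi_commute _ ee) ex /(levi_commute _ ee) ey.
  by apply/(levi_commute _ ee); rewrite mulrA ex -!mulrA ey.
move=> x /(levi_commute _ ee) ex; apply/(levi_commute _ ee).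
by rewrite -{1}se -star_evenr // -ex star_evenl // se.
Qed.

(** Otherwise [e = k + k^*] as in [hyperbolic_split], and [B] stabilizes [k A]. The
    stabilizer of [k A] contains [trace (k z (1 - e))], which does not commute
    with [e] for a suitable [z]. *)
Lemma levi_generation (B : {vspace A}) e : maximal_subalgebra G (jordan_mul G) J B ->
  even_idempotent G e -> star e = e -> e != 1 ->
  B = herm_elts star (corner e + corner (1 - e))%VS ->
  gen_alg (herm_elts star (corner e)) = corner e.
Proof.
move=> maxB [e0 ee] se en1 BE; apply: NNPP => ngen.
have [k [ik kn0 skk ksk [kE kHk]]] := hyperbolic_split (conj e0 ee) se ngen.
have [k0 kk] := ik.
have ek : e * k = k by rewrite -kE mulrDl kk skk addr0.
have ke : k * e = k by rewrite -kE mulrDr kk ksk addr0.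
pose f := 1 - e; have f0 : f \in G false by rewrite memvB ?one_even.
have fk : f * k = 0 by rewrite mulrBl mul1r ek subrr.
have kf : k * f = 0 by rewrite mulrBr mulr1 ke subrr.
have ef : e * f = 0 by rewrite mulrBr mulr1 ee subrr.
have sf : star f = f by rewrite linearB /= star1 se.
have ff : f * f = f by rewrite {1}/f mulrBl mul1r ef subr0.
have fn0 : f != 0 by rewrite subr_eq0 eq_sym.
clearbody f.
have ske : star k * e = star k by rewrite -{1}se -(star_evenl _ e0) ek.
have kn1 : k != 1.
  by apply: contra kn0 => /eqP k1; rewrite -[k]mul1r -star1 -k1 skk.
have Bstab : (B <= stab k)%VS.
  apply/subvP=> b; rewrite BE => /hermP[/(levi_commute _ ee) eb sb].
  apply: stab_herm => //.
  have ebe : e * b * e \in herm_elts star (corner e).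
    by apply/hermP; rewrite star_corner // se sb; split=> //; apply/cornerP; exists b.
  have := kHk _ ebe; rewrite !mulrA ske (mulA_eq ek) => skbk.
  have -> : b * k = e * b * k by rewrite eb -mulrA ek.
  by rewrite -kE !mulrDl skbk addr0.
have BS := maximal_herm maxB (stab_star_subalgebra ik) (stab_proper ik kn0 kn1) Bstab.
case/eqP: kn0; apply: (homog_annihilator k0 f0 fn0) => z.
have tB : trace (k * z * f) \in B.
  rewrite BS; apply/hermP; rewrite star_trace; split=> //.
  apply: stab_herm => //; first exact: star_trace.
  rewrite !traceE star_corner // sf.
  rewrite mulrDr mulrDl [in RHS]mulrDl !mulrA.
  by rewrite !(mulA_eq fk, mulA_eq skk) !(mulr0, mul0r, addr0).
move: tB; rewrite BE => /hermP[/(levi_commute _ ee) te _].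
have : e * trace (k * z * f) * f = 0 by rewrite te -mulrA ef mulr0.
rewrite !traceE star_corner // sf mulrDr mulrDl !mulrA ek.
by rewrite (mulA_eq ff) ef !mul0r addr0.
Qed.


(** * Overalgebras of the Levi and parabolic forms *)

Lemma trace_mul x y : star x * y = 0 -> x * star y = 0 -> star x * star y = 0 ->
  trace (trace x * trace y) = trace (x * y).
Proof.
by move=> xy0 xy1 xy2; rewrite [trace x]traceE [trace y]traceE mulrDr !mulrDl xy0 xy1 xy2 !addr0.
Qed.

(** For Hermitian [b] the trace of [b (trace z)] is that of [b z], the product
    [b z^*] being [0]; so the Hermitian elements of a corner, and with them the
    algebra they generate, preserve the set of [z] whose trace lies in [D]. *)
Lemma trace_corner_action (D : {vspace A}) g w :
  (forall x y, x \in D -> y \in D -> trace (x * y) \in D) ->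
  even_idempotent G g -> w \in G false -> g * star w = 0 ->
  gen_alg (herm_elts star (corner g)) = corner g ->
  (herm_elts star (corner g) <= D)%VS ->
  forall b z : A, b \in corner g -> z * w = z -> trace z \in D -> trace (b * z) \in D.
Proof.
move=> traceD [g0 gg] w0 gsw geng /subvP HgD b z bC; move: z.
suff: b \in corner g /\ forall z : A, z * w = z -> trace z \in D -> trace (b * z) \in D by case.
move: b bC; rewrite -{1}geng; apply: gen_alg_ind => [|b bH|b c [bC Pb] [cC Pc]].
- split=> [|k b c [bC Pb] [cC Pc]].
    by split=> [|z _ _]; rewrite ?mem0v // mul0r linear0 mem0v.
  split=> [|z zw zD]; first by rewrite memvD ?memvZ.
  by rewrite mulrDl -scalerAl linearP /= memvD ?memvZ ?Pb ?Pc.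
- have /hermP[bC sb] := bH; split=> // z zw zD.
  have := traceD _ _ (HgD b bH) zD; rewrite [trace z]traceE mulrDr.
  have -> : b * star z = 0; last by rewrite addr0.
  have /(corner_idem _ gg)[_ bg] := bC.
  by rewrite -zw (star_evenr _ w0) -bg mulrA (mulA_eq gsw) mulr0 mul0r.
by split=> [|z zw zD]; rewrite ?cornerM // -mulrA Pb ?Pc // -mulrA zw.
Qed.

(** The component [y = e x (1 - e)] of [x] is nonzero and has its trace in [D]; the
    two corners act on it from both sides and [e A y A (1 - e) = e A (1 - e)]. *)
Lemma levi_fills (D : {vspace A}) e :
  (forall x y, x \in D -> y \in D -> trace (x * y) \in D) ->
  even_idempotent G e -> star e = e ->
  gen_alg (herm_elts star (corner e)) = corner e ->
  gen_alg (herm_elts star (corner (1 - e))) = corner (1 - e) ->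
  (herm_elts star (corner e + corner (1 - e)) <= D)%VS ->
  forall a x, x \in G a -> star x = x -> x \in D ->
  x \notin (corner e + corner (1 - e))%VS -> (J <= D)%VS.
Proof.
move=> traceD [e0 ee] se gene genf /subvP HD a x xa sx xD /(levi_commute _ ee) xC.
have f0 : 1 - e \in G false by rewrite memvB ?one_even.
have ef : e * (1 - e) = 0 by rewrite mulrBr mulr1 ee subrr.
have fe : (1 - e) * e = 0 by rewrite mulrBl mul1r ee subrr.
have ff : (1 - e) * (1 - e) = 1 - e by rewrite mulrBr mulr1 fe subr0.
have sf : star (1 - e) = 1 - e by rewrite linearB /= star1 se.
have ef1 : e + (1 - e) = 1 by rewrite addrC subrK.
have HeD h : h \in herm_elts star (corner e) -> h \in D.
  by case/hermP=> hC sh; apply/HD/hermP; split=> //; apply: subvP hC; apply: addvSl.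
have HfD h : h \in herm_elts star (corner (1 - e)) -> h \in D.
  by case/hermP=> hC sh; apply/HD/hermP; split=> //; apply: subvP hC; apply: addvSr.
have {}xC : e * x <> x * e by [].
move: (1 - e) genf f0 ef fe ff sf ef1 HfD {HD} => f genf f0 ef fe ff sf ef1 HfD.
have corner_herm i h : i \in G false -> star i = i -> star h = h ->
    i * h * i \in herm_elts star (corner i).
  by move=> i0 si sh; apply/hermP; rewrite star_corner // si sh; split=> //; apply/cornerP; exists h.
have eD : e \in D.
  by apply: HeD; have := corner_herm e e e0 se se; rewrite !ee.
have left (b z : A) : b \in corner e -> z * f = z -> trace z \in D -> trace (b * z) \in D.
  apply: trace_corner_action => //; last exact/subvP.
  by rewrite sf.
have right (b : A) : b \in corner f -> forall z, e * z = z -> trace z \in D -> trace (z * b) \in D.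
  suff: b \in corner f -> b \in corner f /\
      forall z, e * z = z -> trace z \in D -> trace (z * b) \in D by move=> H /H[].
  rewrite -{1}genf; move: b; apply: gen_alg_ind => [|b bH|b c [bC Pb] [cC Pc]].
  - split=> [|c b b' [bC Pb] [bC' Pb']].
      by split=> [|z _ _]; rewrite ?mem0v // mulr0 linear0 mem0v.
    split=> [|z ez zD]; first by rewrite memvD ?memvZ.
    by rewrite mulrDr -scalerAr linearP /= memvD ?memvZ ?Pb ?Pb'.
  - have /hermP[bC sb] := bH; split=> // z ez zD.
    have := traceD _ _ zD (HfD b bH); rewrite [trace z]traceE mulrDl.
    have -> : star z * b = 0; last by rewrite addr0.
    have /(corner_idem _ ff)[fb _] := bC.
    by rewrite -ez (star_evenl _ e0) se -fb mulrA -[_ * e * f]mulrA ef mulr0 mul0r.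
  by split=> [|z ez zD]; rewrite ?cornerM // mulrA Pc ?Pb // mulrA ez.
pose y := e * x * f.
have syE : star y = f * x * e by rewrite star_corner // sf sx se.
have yD : trace y \in D.
  have -> : trace y = trace (e * x) - (e * x * e + e * x * e).
    have exE : e * x = e * x * e + y by rewrite -mulrDr ef1 mulr1.
    have xeE : x * e = e * x * e + f * x * e by rewrite -!mulrDl ef1 mul1r.
    rewrite !traceE syE (star_evenl _ e0) sx se xeE [X in X + _ - _]exE.
    by rewrite addrACA [X in _ = X - _]addrC addrK.
  have exeD : e * x * e \in D by apply/HeD/corner_herm.
  by apply: memvB; [apply: traceD | apply: memvD].
have ya : y \in G a by rewrite even_mulr // even_mull.
have yn0 : y != 0.
  apply/eqP=> y_0; apply: xC.
  have fxe : f * x * e = 0 by rewrite -syE y_0 linear0.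
  rewrite -[e * x]mulr1 -[x * e]mul1r -ef1 mulrDr mulrDl !mulrA fxe.
  by rewrite -/y y_0.
have allD z : trace (e * z * f) \in D.
  move: z; apply: (@two_sided_ind a y (fun z => trace (e * z * f) \in D) _ ya yn0) => [|z w].
    by lin_tac.
  have -> : e * (z * y * w) * f = e * z * e * y * (f * w * f).
    by rewrite /y !mulrA !(mulA_eq ee, mulA_eq ff).
  apply: right; [by apply/cornerP; exists w | by rewrite !mulrA ee |].
  apply: left => //; first by apply/cornerP; exists z.
  by rewrite /y (mulA_eq ff).
apply/subvP=> h /hermP[_ sh].
have -> : h = e * h * e + f * h * f + trace (e * h * f).
  rewrite !traceE star_corner // se sf sh.
  rewrite -[LHS]mul1r -[LHS]mulr1 -ef1 !mulrDl !mulrDr.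
  by rewrite [RHS]addrACA [X in _ = _ + X]addrC.
apply: memvD (allD h); apply: memvD; [apply: HeD|apply: HfD]; exact: corner_herm.
Qed.

Section Parabolic.

Variables r g : A.
Hypotheses (ir : even_idempotent G r) (srr : star r * r = 0) (rsr : r * star r = 0).

Local Notation q := (star r).
Hypothesis gE : g = 1 - r - q.

Let r0 : r \in G false. Proof. by case: ir. Qed.
Let rr : r * r = r. Proof. by case: ir. Qed.
Let q0 : q \in G false. Proof. exact: star_homog. Qed.
Let qq : q * q = q. Proof. by case: (even_star_idem ir). Qed.
Let g0 : g \in G false. Proof. by rewrite gE !memvB ?one_even. Qed.
Let sg : star g = g.
Proof. by rewrite gE !linearB /= star1 starK addrAC. Qed.
Let rg : r * g = 0.
Proof. by rewrite gE !mulrBr mulr1 rr rsr subrr subr0. Qed.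
Let gr : g * r = 0.
Proof. by rewrite gE !mulrBl mul1r rr srr subrr subr0. Qed.
Let qg : q * g = 0.
Proof. by rewrite gE !mulrBr mulr1 qq srr subr0 subrr. Qed.
Let gq : g * q = 0.
Proof. by rewrite gE !mulrBl mul1r qq rsr subr0 subrr. Qed.
Let gg : g * g = g.
Proof. by rewrite {1}gE !mulrBl mul1r rg qg !subr0. Qed.
Let sum1 : r + q + g = 1.
Proof. by rewrite gE -[1 - r - q]addrA -opprD addrCA subrr addr0. Qed.

Definition parabolic : {vspace A} :=
  (right_ideal r + left_ideal q + corner g)%VS.

(** With respect to the orthogonal idempotents [r], [g], [r^*], both sides consist of
    the [x] whose components [g x r], [r^* x g] and [r^* x r] vanish. *)
Lemma parabolic_stab : parabolic = stab r.
Proof.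
apply/eqP; rewrite eqEsubv; apply/andP; split.
  rewrite !subv_add -andbA; apply/and3P; split; apply/subvP=> x.
  - case/right_idealP=> y ->; apply/stabP.
    by rewrite !mulrA rr srr !mul0r.
  - case/left_idealP=> y ->; apply/stabP.
    by rewrite !mulrA !(mulA_eq srr) (mulA_eq qq) !mulr0.
  case/cornerP=> y ->; apply/stabP.
  by rewrite !mulrA rg qg !(mulA_eq gr, mulA_eq gq) !(mulr0, mul0r).
apply/subvP=> x /stabP[xr qx].
have rxr : q * x * r = 0 by rewrite -mulrA -xr !mulrA srr !mul0r.
have qxg : q * x * g = 0 by rewrite gE !mulrBr mulr1 qx rxr subr0 subrr.
have gxr : g * x * r = 0 by rewrite -mulrA -xr !mulrA gr !mul0r.
have -> : x = r * x + (q + g) * x * q + g * x * g.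
  have -> : (q + g) * x * q = (q + g) * x - g * x * g.
    rewrite -[X in _ = X - _]mulr1 -[in RHS]sum1 !mulrDl !mulrDr rxr qxg gxr.
    by rewrite !addr0 !add0r -!addrA subrr addr0.
  by rewrite -addrA subrK -mulrDl addrA sum1 mul1r.
apply: memv_add; last by apply/cornerP; exists x.
by apply: memv_add; [apply/right_idealP; exists x | apply/left_idealP; exists ((q + g) * x)].
Qed.

(** Otherwise [g = k + k^*] as in [hyperbolic_split]; then [(r + k) A] is isotropic
    and stable under [B], while its stabilizer contains [trace (k z r)], which
    moves [r A] for a suitable [z]. *)
Lemma parabolic_generation (B : {vspace A}) :
  maximal_subalgebra G (jordan_mul G) J B -> r != 0 ->
  B = herm_elts star (stab r) ->
  gen_alg (herm_elts star (corner g)) = corner g.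
Proof.
move=> maxB rn0 BE; apply: NNPP => ngen.
have [k [[k0 kk] kn0 skk ksk [kE kHk]]] := hyperbolic_split (conj g0 gg) sg ngen.
have gk : g * k = k by rewrite -kE mulrDl kk skk addr0.
have kg : k * g = k by rewrite -kE mulrDr kk ksk addr0.
have rk : r * k = 0 by rewrite -gk mulrA rg mul0r.
have kr : k * r = 0 by rewrite -kg -mulrA gr mulr0.
have qk : q * k = 0 by rewrite -gk mulrA qg mul0r.
have skr : star k * r = 0 by apply: star_inj; rewrite (star_evenr _ r0) starK qk linear0.
have skg : star k * g = star k by rewrite -[g]sg -(star_evenl _ g0) gk.
pose e := r + k.
have er : e * r = r by rewrite mulrDl rr kr addr0.
have ek : e * k = k by rewrite mulrDl rk kk add0r.
have ie : even_idempotent G e.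
  by split; [rewrite memvD | rewrite {2}/e mulrDr er ek].
have see : star e * e = 0.
  by rewrite linearD /= mulrDl !mulrDr srr qk skr skk !addr0.
have en0 : e != 0.
  by apply: contra rn0 => /eqP e_0; rewrite -er e_0 mul0r.
have en1 : e != 1.
  by apply: contra en0 => /eqP e1; rewrite -[e]mul1r -star1 -{1}e1 see.
have Bstab : (B <= stab e)%VS.
  apply/subvP=> b; rewrite BE => /hermP[/stabP[br qb] sb].
  apply: stab_herm => //; rewrite {2 3}/e !mulrDr; congr (_ + _).
    by rewrite -[LHS]mulrA -br !mulrA er.
  have gbg : g * b * g \in herm_elts star (corner g).
    by apply/hermP; rewrite star_corner // sg sb; split=> //; apply/cornerP; exists b.
  have := kHk _ gbg; rewrite !mulrA skg (mulA_eq gk) => skbk.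
  have qbg : q * b * g = 0.
    have qbr : q * b * r = 0 by rewrite -mulrA -br !mulrA srr !mul0r.
    by rewrite gE !mulrBr mulr1 qb qbr subr0 subrr.
  have qbk : q * b * k = 0 by rewrite -gk mulrA qbg mul0r.
  rewrite -[RHS]mul1r -sum1 -kE !mulrDl !mulrA qbk skbk !addr0.
  by [].
have BS := maximal_herm maxB (stab_star_subalgebra ie) (stab_proper ie en0 en1) Bstab.
case/eqP: kn0; apply: (homog_annihilator k0 r0 rn0) => z.
have tB : trace (k * z * r) \in B.
  rewrite BS; apply/hermP; rewrite star_trace; split=> //.
  apply: stab_herm => //; first exact: star_trace.
  have te : trace (k * z * r) * e = k * z * r.
    rewrite !traceE star_corner // mulrDl /e !mulrDr.
    by rewrite !(mulA_eq rr, mulA_eq rk, mulA_eq skr, mulA_eq skk) !(mulr0, addr0, add0r).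
  by rewrite te -mulrA te !mulrA ek.
move: tB; rewrite BE => /hermP[/stabP[] + _ _].
have -> : r * trace (k * z * r) * r = 0.
  rewrite !traceE star_corner // mulrDr mulrDl !mulrA rk rsr.
  by rewrite !mul0r addr0.
rewrite !traceE star_corner // mulrDl (mulA_eq rr) (mulA_eq skr) mulr0 addr0.
by [].
Qed.

(** Modulo the parabolic, [x] is the sum of [trace (g x r)] and of the Hermitian
    element [r^* x r]. A nonzero component of the first kind spreads over
    [g A r] under the corners of [g] and [r]; products of two such traces then
    give [r^* A r]. A nonzero [h] in [r^* A r] spreads over [r^* A r] under the
    corner of [r], and multiplying it by traces of elements of [g A r^*] leads
    back to [g A r]. *)
Lemma parabolic_fills (D : {vspace A}) :
  (forall x y, x \in D -> y \in D -> trace (x * y) \in D) ->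
  gen_alg (herm_elts star (corner g)) = corner g ->
  (herm_elts star (stab r) <= D)%VS ->
  forall a x, x \in G a -> star x = x -> x \in D -> x \notin stab r -> (J <= D)%VS.
Proof.
move=> traceD geng /subvP HD a x xa sx xD xstab.
have Dstab h : h \in stab r -> star h = h -> h \in D by move=> hs sh; apply/HD/hermP.
rewrite -parabolic_stab in Dstab.
have [_ _ sstab] := stab_star_subalgebra ir.
rewrite -parabolic_stab in sstab.
have rstab z : r * z \in parabolic.
  rewrite -[r * z]addr0 -[_ + 0]addr0; apply: memv_add (mem0v _).
  by apply: memv_add (mem0v _); apply/right_idealP; exists z.
have rD z : trace (r * z) \in D.
  by apply: Dstab; [rewrite traceE memvD ?sstab | apply: star_trace].
have HgD h : h \in herm_elts star (corner g) -> h \in D.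
  case/hermP=> hC sh; apply: Dstab => //.
  by rewrite -[h]add0r; apply: memv_add (mem0v _) hC.
have corner_herm h : star h = h -> g * h * g \in herm_elts star (corner g).
  by move=> sh; apply/hermP; rewrite star_corner // sg sh; split=> //; apply/cornerP; exists h.
have gD : g \in D by apply: HgD; have := corner_herm g sg; rewrite !gg.
have halfD h : star h = h -> trace h \in D -> h \in D.
  by move=> sh hD; rewrite (half_trace sh) memvZ.
have peirce h : star h = h -> h = (trace (r * h) - r * h * q) + g * h * g
    + (trace (g * h * r) + q * h * r).
  move=> sh; rewrite !traceE star_corner // (star_evenl _ r0) sg sh.
  have split s t : r + s = 1 -> t + q = 1 ->
      h = r * h + (h * q - r * h * q) + s * h * t.
    move=> rs1 tq1; have -> : s = 1 - r by rewrite -rs1 addrAC subrr add0r.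
    have -> : t = 1 - q by rewrite -tq1 addrK.
    rewrite [_ * _ * (1 - _)]mulrBr mulr1 !mulrBl !mul1r.
    by rewrite -[h - _ - _]addrA -opprD [RHS]addrC subrK.
  have rq1 : r + (q + g) = 1 by rewrite addrA.
  have rg1 : r + g + q = 1 by rewrite addrAC.
  rewrite {1}[h](split _ _ rq1 rg1) [r * h + (_ - _)]addrA -[RHS]addrA; congr (_ + _).
  rewrite !mulrDl !mulrDr addrC [X in X + _]addrC -!addrA.
  by rewrite [RHS]addrCA; congr (_ + _); rewrite addrCA.
have stab_rest h : star h = h -> h \in D -> trace (g * h * r) + q * h * r \in D.
  move=> sh hD.
  have -> : trace (g * h * r) + q * h * r
      = h - ((trace (r * h) - r * h * q) + g * h * g).
    by apply/eqP; rewrite eq_sym subr_eq [X in _ == X]addrC; apply/eqP/peirce.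
  apply: memvB => //; apply: memvD; last exact/HgD/corner_herm.
  apply: memvB => //; apply: halfD; first by rewrite star_corner // starK sh.
  by rewrite -mulrA.
have skew_part h : star h = h -> h \in D ->
    trace (g * h * r) \in D /\ q * h * r \in D.
  move=> sh hD; set y := trace (g * h * r).
  have rest := stab_rest h sh hD.
  have yD : y \in D.
    have := traceD _ _ gD rest.
    have -> : g * (y + q * h * r) = g * h * r => [|//].
    by rewrite /y traceE star_corner // sg sh !mulrDr !mulrA gg gq !mul0r !addr0.
  by split=> //; have := memvB rest yD; rewrite addrC addKr.
pose T := forall z, trace (q * z * r) \in D.
pose S := forall z, trace (g * z * r) \in D.
have fill : T -> S -> (J <= D)%VS.
  move=> allT allS; apply/subvP=> h /hermP[_ sh].
  rewrite [h]peirce //; apply: memvD; last first.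
    apply: memvD => //; apply: halfD => //.
    by rewrite star_corner // starK sh.
  apply: memvD; last exact/HgD/corner_herm.
  apply: memvB => //; apply: halfD; first by rewrite star_corner // starK sh.
  by rewrite -mulrA.
have fillT b h : h \in G b -> star h = h -> q * h * r = h -> h != 0 -> h \in D -> T.
  move=> hb sh rh hn0 hD.
  have qh : q * h = h by rewrite -rh !mulrA qq.
  have hr : h * r = h by rewrite -rh (mulA_eq rr).
  have act z : trace (h * (r * z * r)) \in D.
    have := traceD _ _ hD (rD (z * r)); rewrite [trace (r * _)]traceE !mulrA.
    rewrite star_corner // mulrDr !mulrA.
    have -> : h * q = 0 by rewrite -hr -mulrA rsr mulr0.
    by rewrite !mul0r addr0.
  (* Acting twice on h yields the trace of (h y)^* z, whose argument is,
     up to sign, a general element of r^* A h A r. *)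
  have act2 y z : trace (star (h * (r * y * r)) * (r * z * r)) \in D.
    set u := h * (r * y * r); set v := r * z * r.
    have vD : trace v \in D by rewrite /v -mulrA.
    have := traceD _ _ (act y) vD; rewrite -/u [trace u]traceE [trace v]traceE.
    have ur : u * r = u by rewrite /u !mulrA (mulA_eq rr).
    have vr : v * r = v by rewrite /v (mulA_eq rr).
    have qu : q * u = u by rewrite /u !mulrA qh.
    have uvE : u * v = h * (r * (y * r * z) * r).
      by rewrite /u /v !mulrA (mulA_eq rr).
    clearbody u v.
    have usv : u * star v = 0.
      rewrite -ur -vr (star_evenr _ r0). by rewrite mulrA (mulA_eq rsr) mulr0 mul0r.
    have susv : star u * star v = 0.
      rewrite -qu -vr (star_evenl _ q0) (star_evenr _ r0) starK mulrA.
      by rewrite (mulA_eq rsr) mulr0 mul0r.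
    rewrite mulrDr !mulrDl usv susv !addr0 linearD /= addrC => uvD.
    by have := memvB uvD (act (y * r * z)); rewrite -uvE addrK.
  have act3 y z : trace (q * y * q * h * (r * z * r)) \in D.
    move: y; apply: homog_ind => [|c y yc]; first by lin_tac.
    have := act2 (star y) z.
    have yc' : r * star y * r \in G c by rewrite even_mulr // even_mull // star_homog.
    rewrite (starM hb yc') star_corner // starK sh.
    by case: ifP => _ //; rewrite mulNr linearN memvN.
  move=> z; apply: (@two_sided_ind b h (fun z => trace (q * z * r) \in D) _ hb hn0) => [|y w].
    by lin_tac.
  have -> : q * (y * h * w) * r = q * y * q * h * (r * w * r).
    by rewrite !mulrA (mulA_eq hr) (mulA_eq qh).
  exact: act3.
have fillS b u : u \in G b -> g * u * r = u -> u != 0 -> trace u \in D -> S.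
  move=> ub gur un0 uD.
  have left c z : c \in corner g -> z * r = z -> trace z \in D -> trace (c * z) \in D.
    by apply: trace_corner_action => //; apply/subvP.
  have right z w : g * z * r = z -> trace z \in D -> trace (z * (r * w * r)) \in D.
    move=> gzr zD; have := traceD _ _ zD (rD (w * r)); rewrite !mulrA trace_mul ?mulrA //.
    - by rewrite -gzr star_corner // sg ?mulrA (mulA_eq gr) mulr0 !mul0r.
    - by rewrite -gzr star_corner // ?mulrA (mulA_eq rsr) mulr0 !mul0r.
    by rewrite -gzr !star_corner // sg !mulrA (mulA_eq gq) mulr0 !mul0r.
  move=> z; apply: (@two_sided_ind b u (fun z => trace (g * z * r) \in D) _ ub un0) => [|y w].
    by lin_tac.
  have gu : g * u = u by rewrite -gur !mulrA gg.
  have ur : u * r = u by rewrite -gur (mulA_eq rr).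
  have -> : g * (y * u * w) * r = (g * y * g * u) * (r * w * r).
    by rewrite !mulrA (mulA_eq ur) (mulA_eq gu).
  apply: right; first by rewrite !mulrA gg (mulA_eq ur).
  by apply: left => //; apply/cornerP; exists y.
have S_T : S -> g != 0 -> T.
  move=> allS gn0 z.
  apply: (@two_sided_ind false g (fun z => trace (q * z * r) \in D) _ g0 gn0) => [|y w].
    by lin_tac.
  have := traceD _ _ (allS (star y)) (allS w).
  have sE : star (g * star y * r) = q * y * g by rewrite star_corner // starK sg.
  rewrite -[trace (g * star y * r)]trace_star sE trace_mul.
  - by rewrite !mulrA (mulA_eq gg).
  - by rewrite star_corner // starK sg !mulrA (mulA_eq rg) mulr0 !mul0r.
  - by rewrite star_corner // !mulrA (mulA_eq gq) mulr0 !mul0r.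
  by rewrite !star_corner // starK sg !mulrA (mulA_eq rsr) mulr0 !mul0r.
have T_S b h : T -> g != 0 -> h \in G b -> star h = h -> q * h * r = h -> h != 0 ->
    h \in D -> S.
  move=> allT gn0 hb sh rh hn0 hD.
  have [c [z [zc nz]]] := prime_homog g0 hb gn0 hn0.
  have qh : q * h = h by rewrite -rh !mulrA qq.
  have hr : h * r = h by rewrite -rh (mulA_eq rr).
  have yD : trace (g * z * q) \in D.
    by rewrite -trace_star star_corner // starK -mulrA.
  apply: (fillS (c (+) b) (g * z * h)) => //.
  - exact: homogM (even_mull g0 zc) hb.
  - by rewrite !mulrA gg (mulA_eq hr).
  have := traceD _ _ yD hD; rewrite [trace (g * z * _)]traceE mulrDl star_corner // starK sg.
  have -> : r * star z * g * h = 0 by rewrite -qh mulrA (mulA_eq gq) mulr0 mul0r.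
  by rewrite addr0 -!mulrA qh.
have [yD hD] := skew_part x sx xD.
have ya : g * x * r \in G a by rewrite even_mulr // even_mull.
have ha : q * x * r \in G a by rewrite even_mulr // even_mull.
have sh : star (q * x * r) = q * x * r by rewrite star_corner // starK sx.
have gyr : g * (g * x * r) * r = g * x * r by rewrite !mulrA gg (mulA_eq rr).
have rhr : q * (q * x * r) * r = q * x * r by rewrite !mulrA qq (mulA_eq rr).
have [y_0|yn0] := eqVneq (g * x * r) 0; last first.
  have allS := fillS a _ ya gyr yn0 yD; apply: fill => //; apply: S_T => //.
  by apply: contra yn0 => /eqP ->; rewrite !mul0r.
have hn0 : q * x * r != 0.
  apply: contra xstab => /eqP h_0; apply: stab_herm => //.
  by rewrite -[RHS]mul1r -sum1 !mulrDl !mulrA y_0 h_0 !addr0.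
have allT := fillT a _ ha sh rhr hn0 hD; apply: fill => //.
have [g_0|gn0] := eqVneq g 0; first by move=> z; rewrite g_0 !mul0r linear0 mem0v.
exact: (T_S a _ allT gn0 ha sh rhr hn0 hD).
Qed.

End Parabolic.

(** * The two standard forms *)

(** If [e A] meets its orthogonal trivially, the two ideals are complementary, and
    the component [u] of [1] in [e A] is a symmetric idempotent. *)
Lemma nondegenerate_idempotent e : even_idempotent G e ->
  (forall x, e * x = x -> star e * x = 0 -> x = 0) ->
  exists u, [/\ even_idempotent G u, star u = u, e * u = u & u * e = e].
Proof.
move=> [e0 ee] nondeg; have [se0 sese] := even_star_idem (conj e0 ee).
pose f := 1 - star e; have f0 : f \in G false by rewrite memvB ?one_even.
have sf : star f = 1 - e by rewrite linearB /= star1 starK.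
pose S := (right_ideal e + right_ideal f)%VS.
have gS : graded_subspace G S.
  by apply: graded_addv; apply: graded_prodv gradedf; apply: graded_line; eassumption.
have idS x y : x \in S -> x * y \in S.
  case/memv_addP=> _ /right_idealP[v ->] [_ /right_idealP[w ->] ->].
  rewrite mulrDl -!mulrA; apply: memv_add; apply/right_idealP; eexists; reflexivity.
have [g [g0 gg _ SE]] := right_ideal_generator gS idS.
have gid x : x \in S -> g * x = x by rewrite SE right_ideal_idem // => /eqP.
have eS : e \in S.
  by rewrite -[e]addr0; apply: memv_add (mem0v _); apply/right_idealP; exists 1; rewrite mulr1.
have fS : f \in S.
  by rewrite -[f]add0r; apply: memv_add (mem0v _) _; apply/right_idealP; exists 1; rewrite mulr1.
(* 1 - g^* is orthogonal to e A and to its orthogonal, hence lies in the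
   intersection of the two. *)
have g1 : g = 1.
  apply: star_inj; rewrite star1; apply/esym/eqP; rewrite -subr_eq0; apply/eqP.
  apply: nondeg.
    have : star f * (1 - star g) = 0.
      by rewrite mulrBr mulr1 -(star_evenl _ g0) (gid _ fS) subrr.
    by rewrite sf mulrBl mul1r => /eqP; rewrite subr_eq0 => /eqP <-.
  by rewrite mulrBr mulr1 -(star_evenl _ g0) (gid _ eS) subrr.
have : 1 \in S by rewrite -g1 SE right_ideal_idem // gg.
case/memv_addP=> u; rewrite right_ideal_idem // => /eqP eu [v] /right_idealP[w vE] uv1.
have sev : star e * v = 0.
  by rewrite vE mulrA mulrBr mulr1 sese subrr mul0r.
have ue : u * e = e.
  apply/eqP; rewrite eq_sym -subr_eq0; apply/eqP.
  have ve : e - u * e = v * e by rewrite -{1}[e]mul1r uv1 mulrDl addrAC subrr add0r.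
  by rewrite ve; apply: nondeg; [rewrite -ve mulrBr ee mulrA eu | rewrite mulrA sev mul0r].
have uu : u * u = u by rewrite -{2}eu mulrA ue eu.
have uodd : part true u = 0.
  apply: nondeg; first by rewrite -(part_evenl _ _ e0) eu.
  have := congr1 (part true) uv1.
  rewrite (homog_partE _ gradA one_even) linearD /= => /esym/eqP.
  rewrite addr_eq0 => /eqP ->; rewrite mulrN -(part_evenl _ _ se0) sev.
  by rewrite linear0 oppr0.
have u0 : u \in G false by rewrite -(part_sum u) uodd addr0 mem_part.
have su : star u = star u * u.
  have : star e * (1 - u) = 0 by rewrite uv1 addrC addKr sev.
  rewrite mulrBr mulr1 => /eqP; rewrite subr_eq0 => /eqP seu.
  have sue : star u * star e = star u by rewrite -(star_evenl _ e0) eu.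
  by rewrite -[in RHS]sue -mulrA -seu sue.
exists u; split=> //.
have := congr1 star su; rewrite starK (star_evenl _ (star_homog u0)) starK => uE.
by rewrite su -uE.
Qed.

Definition standard_form (B : {vspace A}) : Prop :=
  exists (e f : A) (C : {vspace A}),
    [/\ even_idempotent G e, even_idempotent G f, e + f = 1,
        B = herm_elts star C
      & [/\ C = (corner e + corner f)%VS, star e = e, star f = f,
            gen_alg (herm_elts star (corner e)) = corner e
          & gen_alg (herm_elts star (corner f)) = corner f]
        \/
        (C = (right_ideal e + left_ideal (star e) + corner (f * star f)%R)%VS
         /\ gen_alg (herm_elts star (corner (f * star f)))
            = corner (f * star f))].

Lemma maximal_levi (B : {vspace A}) u :
  maximal_subalgebra G (jordan_mul G) J B ->
  even_idempotent G u -> star u = u -> u != 0 -> u != 1 ->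
  (forall b : A, b \in B -> u * b = b * u) -> standard_form B.
Proof.
move=> maxB iu su un0 un1 Bu; have [u0 uu] := iu.
have Bsub : (B <= corner u + corner (1 - u))%VS.
  by apply/subvP=> b bB; apply/(levi_commute _ uu)/Bu.
have Ln : (corner u + corner (1 - u))%VS <> {:A}%VS.
  move=> LA; case/negP: un1; rewrite eq_sym -subr_eq0; apply/eqP.
  have w0 : 1 - u \in G false by rewrite memvB ?one_even.
  apply: (homog_annihilator w0 u0 un0) => z.
  have /(levi_commute _ uu) uz : z \in (corner u + corner (1 - u))%VS by rewrite LA memvf.
  by rewrite mulrBl mul1r uz mulrBl -mulrA uu subrr.
have BE := maximal_herm maxB (levi_star_subalgebra iu su) Ln Bsub.
have iw : even_idempotent G (1 - u).
  by split; rewrite ?memvB ?one_even // mulrBr mulr1 mulrBl mul1r uu subrr subr0.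
have sw : star (1 - u) = 1 - u by rewrite linearB /= star1 su.
exists u, (1 - u), (corner u + corner (1 - u))%VS; split=> //.
  by rewrite addrC subrK.
left; split=> //; first exact: levi_generation maxB iu su un1 BE.
apply: levi_generation maxB iw sw _ _.
  by apply: contra un0 => /eqP; rewrite -[X in _ = X]subr0 => /addrI/eqP; rewrite eqr_opp.
have -> : 1 - (1 - u) = u by rewrite opprB addrC subrK.
by rewrite addvC.
Qed.

Lemma maximal_parabolic (B : {vspace A}) e :
  maximal_subalgebra G (jordan_mul G) J B ->
  even_idempotent G e -> e != 0 -> star e * e = 0 ->
  (forall b : A, b \in B -> e * b * e = b * e) -> standard_form B.
Proof.
move=> maxB ie en0 see Be; have [[BJ _ _] _ _] := maxB.
have sB x : x \in B -> star x = x by move=> /(subvP BJ)/hermP[].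
have [r [[ir srr rsr] [er re rE]]] := isotropic_idempotent ie see.
have [r0 rr] := ir.
have rn0 : r != 0 by apply: contra en0 => /eqP r_0; rewrite -re r_0 mul0r.
have rn1 : r != 1.
  by apply: contra rn0 => /eqP r1; rewrite -[r]mul1r -star1 -{1}r1 srr.
have Bstab : (B <= stab r)%VS.
  apply/subvP=> b bB; apply: stab_herm => //; first exact: sB.
  have ber : e * b * r = b * r.
    have := Be b bB => /(congr1 ( *%R^~ r)).
    by rewrite -!mulrA er.
  by rewrite -[LHS]mulrA -ber !mulrA re.
have BE := maximal_herm maxB (stab_star_subalgebra ir) (stab_proper ir rn0 rn1) Bstab.
have sr1 : (1 - r) * star (1 - r) = 1 - r - star r.
  by rewrite linearB /= star1 mulrBr mulr1 mulrBl mul1r rsr subr0.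
exists r, (1 - r), (stab r); split=> //.
- by split; rewrite ?memvB ?one_even // mulrBr mulr1 mulrBl mul1r rr subrr subr0.
- by rewrite addrC subrK.
right; rewrite sr1 -(parabolic_stab ir srr rsr erefl); split=> //.
exact: parabolic_generation maxB rn0 BE.
Qed.

(** A minimal right ideal stable under the unital hull of [B'] is either isotropic
    or complemented by its orthogonal. *)
Lemma maximal_standard (B : {vspace A}) : (2 < \dim J)%N ->
  maximal_subalgebra G (jordan_mul G) J B -> gen_alg B <> {:A}%VS ->
  standard_form B.
Proof.
move=> dimJ maxB genB; have [[BJ gB _] _ _] := maxB.
have sB x : x \in B -> star x = x by move=> /(subvP BJ)/hermP[].
have [BgB /prodvP mulgB _] := gen_alg_spec B.
have ggB := graded_gen_alg gB.
have sgB x : x \in gen_alg B -> star x \in gen_alg B.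
  by apply: gen_alg_star => // {}x xB; rewrite sB.
pose M := (gen_alg B + <[1]>)%VS.
have g1 := graded_line one_even.
have subM : star_subalgebra M.
  split; first exact: graded_addv.
    move=> _ _ /memv_addP[x xB [_ /vlineP[c ->] ->]] /memv_addP[y yB [_ /vlineP[d ->] ->]].
    rewrite mulrDr !mulrDl -!scalerAr -!scalerAl !mulr1 mul1r scalerA addrA.
    by rewrite memv_add ?memvD ?memvZ ?memv_line ?mulgB.
  move=> _ /memv_addP[x xB [_ /vlineP[c ->] ->]].
  by rewrite linearD linearZ /= star1 memv_add ?sgB ?memvZ ?memv_line.
have [gM mulM sM] := subM.
have M1 : 1 \in M by rewrite -[1]add0r memv_add ?mem0v ?memv_line.
have BM : (B <= M)%VS by apply: subv_trans BgB (addvSl _ _).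
(* If M were A, then B' would be a graded ideal, hence 0, and A = F 1 would be
   too small for dimJ. *)
have Mn : M <> {:A}%VS.
  move=> MA; case: simpleA => _ /(_ (gen_alg B))[||//].
    split=> //; first exact: subvf.
    move=> x y; rewrite -MA => /memv_addP[u uB [_ /vlineP[c ->] ->]] yB.
    rewrite mulrDl mulrDr -scalerAl -scalerAr mul1r mulr1.
    by split; rewrite memvD ?memvZ ?mulgB.
  move=> gB0; move: MA; rewrite /M gB0 add0v => A1.
  have := leq_trans dimJ (dimvS (subvf J)).
  by rewrite -A1 dim_vline; case: (_ != 0).
have [a [y [ya yn0 yMA]]] : exists a y, [/\ y \in G a, y != 0
    & 1 \notin (M * <[y]> * {:A})%VS].
  apply: NNPP => none; apply: Mn; apply/eqP; rewrite eqEsubv subvf -corner1.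
  apply/subvP; apply: (@irreducible_full M 1) => //.
  - exact: one_even.
  - exact: star1.
  - exact: oner_neq0.
  - by move=> x _; rewrite mul1r mulr1.
  by move=> a y ya _ yn0; apply: contraT => yMA; case: none; exists a, y.
pose stable (R : {vspace A}) := [/\ graded_subspace G R, forall x z, x \in R -> x * z \in R,
  forall m x, m \in M -> x \in R -> m * x \in R, R != 0%VS & R <> {:A}%VS].
have [R [gR idR MR Rn0 RnA] minR] : exists2 R, stable R &
    forall U, stable U -> (\dim R <= \dim U)%N.
  apply: ex_minimal; exists (M * <[y]> * {:A})%VS; split.
  - exact: graded_prodv (graded_prodv gM (graded_line ya)) gradedf.
  - move=> x z; move: x; apply: prodv_ind => [|u v uU _]; first by lin_tac.
    by rewrite -mulrA memv_mul ?memvf.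
  - move=> m x mM; move: x; apply: prodv3_ind => [|u v uM _]; first by lin_tac.
    rewrite !mulrA; exact: memv_mul (memv_mul (mulM _ _ mM uM) (memv_line y)) (memvf v).
  - apply: contra yn0 => /eqP MyA0; rewrite -memv0 -MyA0.
    by have := memv_mul (memv_mul M1 (memv_line y)) (memvf 1); rewrite mul1r mulr1.
  by move=> MyA; case/negP: yMA; rewrite MyA memvf.
have [e [e0 ee eR RE]] := right_ideal_generator gR idR.
have ie : even_idempotent G e by [].
have eid x : x \in R -> e * x = x by rewrite RE right_ideal_idem // => /eqP.
have [se0 sese] := even_star_idem ie.
have en0 : e != 0.
  apply: contra Rn0 => /eqP e_0; apply/eqP/vspaceP=> x.
  by rewrite RE e_0 right_ideal_idem ?mulr0 // mul0r memv0 eq_sym.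
have en1 : e <> 1.
  move=> e1; apply: RnA; apply/vspaceP=> x.
  by rewrite RE e1 right_ideal_idem ?mulr1 // mul1r eqxx memvf.
have Me m : m \in M -> e * m * e = m * e by move=> mM; rewrite -mulrA eid ?MR.
have eM m : m \in M -> star e * m * star e = star e * m.
  move=> mM; have /(congr1 star) := Me _ (sM _ mM).
  by rewrite star_corner // (star_evenr _ e0) !starK.
pose K := (R :&: lker (amull (star e)))%VS.
have KP x : reflect (e * x = x /\ star e * x = 0) (x \in K).
  rewrite memv_cap memv_ker /amull lfunE /= RE right_ideal_idem //.
  by apply: (iffP andP) => -[/eqP-> /eqP->].
(* K is the intersection of R with its orthogonal, again a stable right ideal. *)
have [K0|Kn0] := eqVneq K 0%VS; last first.
  have KR : K = R.
    apply/eqP; rewrite eqEdim capvSl; apply: minR; split=> //.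
    - apply/gradedP=> b x /KP[ex sex]; apply/KP.
      by rewrite -(part_evenl _ _ e0) ex -(part_evenl _ _ se0) sex linear0.
    - by move=> x z /KP[ex sex]; apply/KP; rewrite !mulrA ex sex mul0r.
    - move=> m x mM /KP[ex sex]; apply/KP; split.
        by rewrite -{1}ex !mulrA Me // -mulrA ex.
      by rewrite mulrA -eM // -mulrA sex mulr0.
    by move=> KA; apply: RnA; apply/eqP; rewrite eqEsubv subvf -KA capvSl.
  have see : star e * e = 0 by have /KP[] : e \in K by rewrite KR.
  apply: (maximal_parabolic maxB ie en0 see) => b bB.
  exact/Me/(subvP BM).
have [x ex sex|u [iu su eu ue]] := nondegenerate_idempotent ie.
  by apply/eqP; rewrite -memv0 -K0; apply/KP.
have [u0 uu] := iu.
have uM m : m \in M -> u * m = m * u.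
  have um k : k \in M -> u * k * u = k * u.
    move=> kM; have eku : e * k * u = k * u.
      by have /(congr1 ( *%R^~ u)) := Me _ kM; rewrite -!mulrA eu.
    by rewrite -[LHS]mulrA -eku !mulrA ue.
  move=> mM; rewrite -um //; have /(congr1 star) := um _ (sM _ mM).
  by rewrite star_corner // (star_evenr _ u0) su starK.
have un1 : u != 1.
  by apply/eqP=> u1; apply: en1; rewrite -[e]mulr1 -u1 eu.
have un0 : u != 0 by apply: contra en0 => /eqP u_0; rewrite -ue u_0 mul0r.
by apply: (maximal_levi maxB iu su un0 un1) => b bB; apply/uM/(subvP BM).
Qed.

(** Modulo [e A + A e^*], the trace of the product of [trace (e y^* )] and
    [trace (e z)] is the trace of [y e^* e z], and such elements span [A]. *)
Lemma nonisotropic_fills e (C : {vspace A}) : even_idempotent G e ->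
  (right_ideal e + left_ideal (star e) <= C)%VS ->
  (forall x y, x \in herm_elts star C -> y \in herm_elts star C ->
     trace (x * y) \in herm_elts star C) ->
  star e * e != 0 -> (J <= C)%VS.
Proof.
move=> [e0 ee] /subvP sub traceC nz; have se0 := star_homog e0.
have eC z : trace (e * z) \in C.
  rewrite traceE (star_evenl _ e0); apply/sub/memv_add.
    by apply/right_idealP; exists z.
  by apply/left_idealP; exists (star z).
have eB z : trace (e * z) \in herm_elts star C.
  by apply/hermP; split; [apply: eC | apply: star_trace].
have all z : trace z \in C.
  move: z; apply: (@two_sided_ind false (star e * e)
    (fun z => trace z \in C) _ (even_mull se0 e0) nz) => [|y z]; first by lin_tac.
  have /hermP[+ _] := traceC _ _ (eB (star y)) (eB z).
  have -> : trace (e * star y) * trace (e * z) = e * (star y * trace (e * z))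
      + y * star e * star z * star e + y * (star e * e) * z.
    rewrite ![in LHS]traceE !(star_evenl _ e0) starK mulrDl -addrA; congr (_ + _).
      by rewrite traceE (star_evenl _ e0) -mulrA.
    by rewrite mulrDr addrC !mulrA.
  have eC' : trace (y * star e * star z * star e) \in C.
    by rewrite -trace_star (star_evenr _ se0) starK.
  rewrite 2!linearD /= => H; have := memvB H (memvD (eC (star y * trace (e * z))) eC').
  by rewrite [_ - _]addrC addKr.
by apply/subvP=> h /hermP[_ sh]; rewrite (half_trace sh) memvZ.
Qed.

Lemma standard_maximal (B : {vspace A}) :
  graded_subalgebra G (jordan_mul G) J B -> gen_alg B <> {:A}%VS ->
  standard_form B ->
  maximal_subalgebra G (jordan_mul G) J B.
Proof.
move=> subB genB [e [f [C [ie if_ ef1 BE forms]]]].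
have [BJ gB _] := subB.
have BnJ : B <> J by move=> BJE; apply: genB; rewrite BJE.
split=> // D subD DnJ BD.
have traceD x y : x \in D -> y \in D -> trace (x * y) \in D.
  exact: jordan_trace subD.
have [DJ gD _] := subD.
apply: NNPP => DnB.
have [a [x [xa xD xB]]] : exists a x, [/\ x \in G a, x \in D & x \notin B].
  apply: graded_homog_notin => //; apply/negP=> DB; apply: DnB.
  by apply/eqP; rewrite eqEsubv DB.
have /hermP[_ sx] := subvP DJ _ xD.
have xC : x \notin C by apply: contra xB => xC; rewrite BE; apply/hermP.
apply: DnJ; apply/eqP; rewrite eqEsubv DJ /=.
have fE : f = 1 - e by rewrite -ef1 addrC addKr.
rewrite BE in BD.
case: forms => [[CE se _ gene genf]|[CE geng]].
  rewrite CE fE in BD xC; rewrite fE in genf.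
  exact: (levi_fills traceD ie se gene genf BD xa sx xD xC).
have see : star e * e = 0.
  apply/eqP/negPn/negP=> nz.
  have JC : (J <= C)%VS.
    apply: (nonisotropic_fills ie) => //; first by rewrite CE addvSl.
    by rewrite -BE => y z; apply: jordan_trace subB.
  by case/negP: xC; apply: subvP JC _ (subvP DJ _ xD).
have [r [[ir srr rsr] [er re rE]]] := isotropic_idempotent ie see.
have [[e0 ee] [r0 rr]] := (ie, ir).
have gE : f * star f = 1 - r - star r.
  rewrite fE linearB /= star1 mulrBr mulr1 mulrBl mul1r.
  by rewrite -[LHS]addrA -opprD -[RHS]addrA -opprD rE addrA.
have Cstab : C = stab r.
  rewrite CE -(parabolic_stab ir srr rsr gE); congr (_ + _ + _)%VS.
    apply/vspaceP=> y; rewrite !right_ideal_idem //.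
    by apply/eqP/eqP=> [<-|<-]; rewrite mulrA ?re ?er.
  apply/vspaceP=> y; apply/left_idealP/left_idealP=> -[z ->].
    by exists (z * star e); rewrite -mulrA -(star_evenl _ r0) re.
  by exists (z * star r); rewrite -mulrA -(star_evenl _ e0) er.
rewrite Cstab in BD xC; exact: (parabolic_fills ir srr rsr gE traceD geng BD xa sx xD xC).
Qed.

End Maximal.

End Super.

Theorem theorem5p2 (F : closedFieldType) (char0 : [pchar F] =i pred0)
    (A : falgType F) (G : bool -> {vspace A}) (star : 'End(A))
    (gradA : super_grading G)
    (simpleA : simple_superalgebra G *%R {:A}%VS)
    (starP : superinvolution G star)
    (J : {vspace A}) (defJ : J = herm_elts star {:A}%VS)
    (dimJ : (2 < \dim J)%N)
    (B : {vspace A}) (subB : graded_subalgebra G (jordan_mul G) J B)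
    (genB : gen_alg B <> {:A}%VS) :
  maximal_subalgebra G (jordan_mul G) J B <->
  exists (e f : A) (C : {vspace A}),
    [/\ even_idempotent G e, even_idempotent G f, e + f = 1,
        B = herm_elts star C
      & [/\ C = (corner e + corner f)%VS, star e = e, star f = f,
            gen_alg (herm_elts star (corner e)) = corner e
          & gen_alg (herm_elts star (corner f)) = corner f]
        \/
        (C = (right_ideal e + left_ideal (star e) + corner (f * star f)%R)%VS
         /\ gen_alg (herm_elts star (corner (f * star f)))
            = corner (f * star f))].
Proof.
have two_neq0 : 2%:R != 0 :> F.
  by have := char0 2%N; rewrite !inE => /negbT.
rewrite {J}defJ in dimJ subB *.
have genJ := gen_alg_hermf gradA starP two_neq0 simpleA dimJ.
split=> [maxB|]; last exact: standard_maximal.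
exact: maximal_standard.
Qed.
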